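(* Let $\Omega\subset\mathbb{R}^d$ be closed, convex and bounded with $\max_{x,y\in\Omega}\|x-y\|\le D$, and let $f:\mathbb{R}^d\to\mathbb{R}$, $f(x)=\mathbb{E}_\xi[F(x,\xi)]$, be convex with $\|\nabla f(x)-\nabla f(y)\|\le L\|x-y\|$ for all $x,y\in\Omega$. Let $x^*$ be a minimum point of $f$ over $\Omega$. Consider solving $\min_{x\in\Omega} f(x)$ by the Stochastic Frank-Wolfe algorithm (described in the context) run for $T$ iterations. (a) (First-order setting.) Assume access to the stochastic first-order oracle and that for every $x\in\Omega$ $$\mathbb{E}_\xi\|\nabla F(x,\xi)-\nabla f(x)\|^2\le 2\rho L\,[f(x)-f(x^* )].$$ Then, with $g_t=\tilde\nabla_t$ and $$\gamma_t=\frac{4}{t+3},\qquad b_t=\lceil (t+3)/2\rceil,$$ the iterates satisfy, for every $1\le t\le T$, $$\mathbb{E}[f(x_t)-f(x^* )]\le\frac{2(f(x_0)-f(x^* ))+8(\rho+1)LD^2}{t+3}.$$ Hence the total numbers of calls to the stochastic first-order oracle and to the linear minimization oracle required to find an $\epsilon$-optimal point are bounded, respectively, by $\mathcal{O}(\epsilon^{-2})$ and $\mathcal{O}(\epsilon^{-1})$. (b) (Zeroth-order setting.) Assume access to the stochastic zeroth-order oracle, that almost surely $\|\nabla F(x,\xi)-\nabla F(y,\xi)\|\le L\|x-y\|$ for all $x,y\in\mathbb{R}^d$, and that for every $x\in\Omega$ $$\mathbb{E}_\xi\|\nabla F(x,\xi)\|^2\le 2\rho L\,[f(x)-f(x^*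 )].$$ Then, with $g_t=\bar G_\nu^t$ and $$\gamma_t=\frac{4}{t+3},\qquad b_t=(t+3)(d+4),\qquad \nu=\frac{D}{(T+3)(d+6)^{3/2}},$$ the iterates satisfy, for every $1\le t\le T$, $$\mathbb{E}[f(x_t)-f(x^* )]\le\frac{2(f(x_0)-f(x^* ))+8(\rho+\rho^{-1}+1)LD^2}{t+3}.$$ Hence the total numbers of calls to the stochastic zeroth-order oracle and to the linear minimization oracle required to find an $\epsilon$-optimal point are bounded, respectively, by $\mathcal{O}(d\epsilon^{-2})$ and $\mathcal{O}(\epsilon^{-1})$.
   Context: Here $\xi$ is a random vector, $\|\cdot\|$ is the Euclidean norm, $L,D,\rho>0$ are constants, and $\nabla F(x,\xi)$ is the gradient in $x$. The stochastic gradients are unbiased: $\mathbb{E}_\xi[\nabla F(x,\xi)]=\nabla f(x)$. A call to the stochastic first-order oracle returns $\nabla F(x,\xi)$ for a queried $x$ and a fresh sample $\xi$; a call to the stochastic zeroth-order oracle returns a value $F(x,\xi)$ (it can be evaluated at two points with the same $\xi$); a call to the linear minimization oracle returns a minimizer of a linear function over $\Omega$. Stochastic Frank-Wolfe algorithm. Input: $x_0\in\Omega$, number of iterations $T$, step sizes $\gamma_t\in[0,1]$, mini-batch sizes $b_t$ (and $\nu>0$ in the zeroth-order setting). For $t=1,\dots,T$: compute a gradient estimate $g_t$; compute $d_t\in\arg\min_{v\in\Omega}\langle v,g_t\rangle$; set $x_t=x_{t-1}+\gamma_t(d_t-x_{t-1})$. Output $x_T$. Gradient estimates. At iteration $t$,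 fresh i.i.d. samples $\xi_{t,1},\dots,\xi_{t,b_t}$ of $\xi$ are drawn. In the first-order setting $g_t=\tilde\nabla_t:=\frac1{b_t}\sum_{i=1}^{b_t}\nabla F(x_{t-1},\xi_{t,i})$. In the zeroth-order setting $$g_t=\bar G_\nu^t:=\frac1{b_t}\sum_{j=1}^{b_t}\frac{F(x_{t-1}+\nu u_{t,j},\xi_{t,j})-F(x_{t-1},\xi_{t,j})}{\nu}\,u_{t,j},$$ where $u_{t,1},\dots,u_{t,b_t}$ are i.i.d. standard Gaussian $N(0,\mathbf{I}_d)$, independent of the $\xi_{t,j}$. All samples are independent across iterations. An $\epsilon$-optimal point is a (random) output $x_T\in\Omega$ with $\mathbb{E}[f(x_T)-f(x^* )]\le\epsilon$. The $\mathcal{O}(\cdot)$ is as $\epsilon\to0$, with hidden constants depending only on $L$, $D$, $\rho$, $f(x_0)-f(x^* )$ (in particular not on $d$). *)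

(* Defs.v *)
From HB Require Import structures.
From mathcomp Require Import all_boot all_order all_algebra.
From mathcomp Require Import all_classical all_reals all_analysis.

Set Implicit Arguments.
Unset Strict Implicit.
Unset Printing Implicit Defensive.

Import Order.TTheory GRing.Theory Num.Theory.
Import numFieldNormedType.Exports.

Local Open Scope classical_set_scope.
Local Open Scope ring_scope.

(* Row vectors carry the product sigma-algebra, generated by the coordinates;
   over R it is the Borel sigma-algebra of R^d. *)
Section measurable_rV.
Context {disp : measure_display} {T : measurableType disp}.
Variable n : nat.

Let coors : 'I_n -> 'rV[T]_n -> T := fun i x => x ord0 i.

Let rV_set0 : g_sigma_preimage coors set0.
Proof. exact: sigma_algebra0. Qed.

Let rV_setC A : g_sigma_preimage coors A -> g_sigma_preimage coors (~` A).
Proof. exact: sigma_algebraC. Qed.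

Let rV_bigcup (F : (set 'rV[T]_n)^nat) : (forall i, g_sigma_preimage coors (F i)) ->
  g_sigma_preimage coors (\bigcup_i (F i)).
Proof. exact: sigma_algebra_bigcup. Qed.

HB.instance Definition _ := @isMeasurable.Build (measure_tuple_display disp)
  'rV[T]_n (g_sigma_preimage coors) rV_set0 rV_setC rV_bigcup.
End measurable_rV.

Section euclidean.
Context {R : realType} {d : nat}.
Implicit Types (u v x : 'rV[R]_d) (Omega : set 'rV[R]_d).

Definition dotp u v : R := \sum_(i < d) u ord0 i * v ord0 i.

(* The library norm `|u| on row vectors is the sup norm. *)
Definition enorm u : R := Num.sqrt (dotp u u).

(* The gradient is meaningful at points of differentiability, which is always
   assumed separately. *)
Definition grad (f : 'rV[R]_d -> R) x : 'rV[R]_d :=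
  \row_(i < d) 'D_(delta_mx ord0 i) f x.

Definition lmo_answer Omega (g v : 'rV[R]_d) : Prop :=
  Omega v /\ forall w, Omega w -> dotp v g <= dotp w g.

End euclidean.

Section probability.
Context {R : realType} {dW : measure_display} {W : measurableType dW}.
Variable P : probability W R.

Definition independent (I : eqType) (S : I -> set (set W)) : Prop :=
  forall (s : seq I) (A : I -> set W), uniq s ->
    (forall i, i \in s -> S i (A i)) ->
    P (\bigcap_(i in [set` s]) A i) = (\prod_(i <- s) P (A i))%E.

(* Law N(0, I_d), i.e. i.i.d. N(0, 1) coordinates *)
Definition std_gaussian d (u : {RV P >-> 'rV[R]_d}) : Prop :=
  forall B : 'I_d -> set R, (forall i, measurable (B i)) ->
    P [set w | forall i, B i (u w ord0 i)] =
    (\prod_(i < d) normal_prob 0 1 (B i))%E.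

Section freshness.
Context {d : nat}.
(* K t indexes the samples drawn at iteration t; S t k is the sigma-algebra of
   sample k of iteration t. *)
Variables (K : nat -> eqType) (S : forall t, K t -> set (set W)).
Variable v : nat -> {RV P >-> 'rV[R]_d}.

(* Everything drawn, or answered by the linear minimization oracle, during
   iterations 1, ..., t. The answers are included because the oracle may choose
   among several minimizers by means of its own. *)
Definition history (t : nat) : set (set W) :=
  <<s [set A | exists2 s : nat, (0 < s <= t)%N &
         g_sigma_algebra_preimage (v s) A \/ exists k : K s, S k A] >>.

(* Samples of one iteration are independent of one another and of the past, so
   that all samples are independent across iterations. *)
Definition fresh (T : nat) : Prop :=
  forall t, (t < T)%N ->
    independent (fun o : option (K t.+1) =>
                   if o is Some k then S k else history t).

End freshness.
End probability.

Section problem.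
Context {R : realType} {d : nat} {dX : measure_display} {Xi : measurableType dX}.
Implicit Types (Pxi : probability Xi R) (Omega : set 'rV[R]_d)
  (F : 'rV[R]_d -> Xi -> R) (f : 'rV[R]_d -> R) (x xstar : 'rV[R]_d).

(* Pxi is the law of the random vector xi. *)
Record sfw_problem (L D : R) Pxi Omega F f (x0 xstar : 'rV[R]_d) : Prop := SfwProblem {
  pb_closed : closed Omega ;
  pb_convex : convex_set Omega ;
  pb_diameter : forall x y, Omega x -> Omega y -> enorm (x - y) <= D ;
  pb_start : Omega x0 ;
  pb_minimum : Omega xstar /\ forall x, Omega x -> f xstar <= f x ;
  pb_F_measurable : measurable_fun setT (fun p : 'rV[R]_d * Xi => F p.1 p.2) ;
  pb_F_differentiable : forall z x, Omega x -> differentiable (F ^~ z) x ;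
  pb_F_integrable : forall x, Pxi.-integrable setT (fun z => (F x z)%:E) ;
  pb_mean : forall x, 'E_Pxi[F x]%E = (f x)%:E ;
  pb_f_convex : convex_function setT f ;
  pb_f_differentiable : forall x, Omega x -> differentiable f x ;
  pb_f_smooth : forall x y, Omega x -> Omega y ->
    enorm (grad f x - grad f y) <= L * enorm (x - y) ;
  pb_grad_integrable : forall x i, Omega x ->
    Pxi.-integrable setT (fun z => (grad (F ^~ z) x ord0 i)%:E) ;
  pb_unbiased : forall x i, Omega x ->
    'E_Pxi[fun z => grad (F ^~ z) x ord0 i]%E = (grad f x ord0 i)%:E
}.

Definition first_order_assumption (L rho : R) Pxi Omega F f xstar : Prop :=
  forall x, Omega x ->
    ('E_Pxi[fun z => (enorm (grad (F ^~ z) x - grad f x) ^+ 2)%R]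
       <= (2 * rho * L * (f x - f xstar))%:E)%E.

Record zeroth_order_assumption (L rho : R) Pxi Omega F f xstar : Prop :=
  ZerothOrderAssumption {
  zo_differentiable : forall z x, differentiable (F ^~ z) x ;
  zo_smooth : {ae Pxi, forall z, forall x y,
    enorm (grad (F ^~ z) x - grad (F ^~ z) y) <= L * enorm (x - y)} ;
  zo_growth : forall x, Omega x ->
    ('E_Pxi[fun z => (enorm (grad (F ^~ z) x) ^+ 2)%R]
       <= (2 * rho * L * (f x - f xstar))%:E)%E
}.

Definition fo_estimate F (b : nat) x (xi : nat -> Xi) : 'rV[R]_d :=
  b%:R^-1 *: \sum_(i < b) grad (F ^~ (xi i)) x.

Definition zo_estimate F (nu : R) (b : nat) x (xi : nat -> Xi)
    (u : nat -> 'rV[R]_d) : 'rV[R]_d :=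
  b%:R^-1 *: \sum_(j < b) ((F (x + nu *: u j) (xi j) - F x (xi j)) / nu *: u j).

End problem.

(* x_t, determined by the oracle answers v_1, ..., v_t *)
Fixpoint sfw_iterate {R : realType} {d : nat} {W : Type} (gamma : nat -> R)
    (x0 : 'rV[R]_d) (v : nat -> W -> 'rV[R]_d) (t : nat) (w : W) : 'rV[R]_d :=
  if t is s.+1 then
    sfw_iterate gamma x0 v s w + gamma s.+1 *: (v s.+1 w - sfw_iterate gamma x0 v s w)
  else x0.

Section runs.
Context {R : realType} {d : nat} {dX : measure_display} {Xi : measurableType dX}
  {dW : measure_display} {W : measurableType dW} (P : probability W R).
Variables (Pxi : probability Xi R) (Omega : set 'rV[R]_d)
  (F : 'rV[R]_d -> Xi -> R) (x0 : 'rV[R]_d).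
Variables (gamma : nat -> R) (b : nat -> nat).

(* At iteration t the samples are those with index i < b t; other values of the
   families xi, u and v are irrelevant. *)
Record first_order_run (T : nat) (xi : nat -> nat -> {RV P >-> Xi})
    (v : nat -> {RV P >-> 'rV[R]_d}) : Prop := FirstOrderRun {
  fo_law : forall t i A, (0 < t <= T)%N -> (i < b t)%N -> measurable A ->
    P (xi t i @^-1` A) = Pxi A ;
  fo_fresh : fresh
    (fun t (i : 'I_(b t)) => g_sigma_algebra_preimage (xi t i)) v T ;
  fo_lmo : forall t w, (t < T)%N ->
    lmo_answer Omega
      (fo_estimate F (b t.+1) (sfw_iterate gamma x0 v t w)
         (fun i => xi t.+1 i w))
      (v t.+1 w)
}.

Record zeroth_order_run (nu : R) (T : nat) (xi : nat -> nat -> {RV P >-> Xi})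
    (u : nat -> nat -> {RV P >-> 'rV[R]_d}) (v : nat -> {RV P >-> 'rV[R]_d}) :
    Prop := ZerothOrderRun {
  zo_law : forall t j A, (0 < t <= T)%N -> (j < b t)%N -> measurable A ->
    P (xi t j @^-1` A) = Pxi A ;
  zo_gaussian : forall t j, (0 < t <= T)%N -> (j < b t)%N -> std_gaussian (u t j) ;
  zo_fresh : fresh
    (fun t (k : 'I_(b t) + 'I_(b t)) =>
       match k with
       | inl j => g_sigma_algebra_preimage (xi t j)
       | inr j => g_sigma_algebra_preimage (u t j)
       end) v T ;
  zo_lmo : forall t w, (t < T)%N ->
    lmo_answer Omega
      (zo_estimate F nu (b t.+1) (sfw_iterate gamma x0 v t w)
         (fun j => xi t.+1 j w) (fun j => u t.+1 j w))
      (v t.+1 w)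
}.

Definition eps_optimal (f : 'rV[R]_d -> R) (xstar : 'rV[R]_d) (eps : R)
    (X : W -> 'rV[R]_d) : Prop :=
  (forall w, Omega (X w)) /\
  ('E_P[fun w => (f (X w) - f xstar)%R] <= eps%:E)%E.

End runs.

Definition step_size {R : realType} (t : nat) : R := 4 / (t%:R + 3).

(* uphalf n is the ceiling of n / 2 *)
Definition fo_batch (t : nat) : nat := uphalf (t + 3).

Definition zo_batch (d t : nat) : nat := ((t + 3) * (d + 4))%N.

Definition zo_radius {R : realType} (D : R) (d T : nat) : R :=
  D / ((T%:R + 3) * ((d%:R + 6) `^ (3 / 2))).

(* Each of the b t samples of iteration t costs one gradient evaluation, or two
   function evaluations; each iteration makes one linear minimization. *)
Definition first_order_calls (b : nat -> nat) (T : nat) : nat :=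
  (\sum_(1 <= t < T.+1) b t)%N.

Definition zeroth_order_calls (b : nat -> nat) (T : nat) : nat :=
  (\sum_(1 <= t < T.+1) 2 * b t)%N.

Definition lmo_calls (T : nat) : nat := (\sum_(1 <= t < T.+1) 1)%N.

(* Main.v *)
Require Import Defs.
From HB Require Import structures.
From mathcomp Require Import all_boot all_order all_algebra.
From mathcomp Require Import all_classical all_reals all_analysis.
From mathcomp Require Import measurable_realfun ring lra zify.

(** With [e_t = grad f (x_(t-1)) - g_t] and [delta_t = f (x_t) - f xstar], the
descent lemma, convexity and the optimality of the oracle answer give
  [delta_t <= (1 - gamma_t) delta_(t-1) + gamma_t <e_t, v_t - xstar>
    + L gamma_t^2 D^2 / 2].
By Young's inequality the error term costs a multiple of [|e_t|^2], and
independence of the samples from the past gives [E|e_t|^2 <= 2 rho L E delta_(t-1) / b_t],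
so that half of the contraction survives:
  [E delta_t <= (1 - gamma_t / 2) E delta_(t-1) + gamma_t^2 K / 2],
which integrates to the rate [O(1 / t)].

In the zeroth-order setting Gaussian smoothing is bypassed: the estimator is the
unbiased [<grad F, u> u], whose second moment is at most [(d + 2) |grad F|^2], plus a
remainder of norm at most [nu L |u|^3 / 2], absorbed by the choice of [nu]. *)

Set Implicit Arguments.
Unset Strict Implicit.
Unset Printing Implicit Defensive.

Import Order.TTheory GRing.Theory Num.Theory.
Import numFieldNormedType.Exports.

Local Open Scope classical_set_scope.
Local Open Scope ring_scope.

(** * Euclidean calculus *)

(** Everything hangs on the weight in Young's inequality. Taken proportional to [gamma_t], it splits
    the error term into a part of order [gamma_t ^+ 2], harmless for the rate, and a fixed multiple
    of [|e_t|^2]. The growth condition makes the expectation of the latter proportional to the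
    expected gap, and a batch of order [1 / gamma_t] (times [d + 4] without gradients) brings it
    below half of the contraction.

    No conditional expectation appears: the joint law of the iterate and a fresh sample is a product
    measure, and Fubini lets the iterate be frozen. The effort goes into independence, which is
    given for events of single samples but needed for pairs: an iterate with a sample, or a sample
    with its Gaussian direction. Oracle answers need not be functions of the samples; they enter
    only through pointwise inequalities and through the past.

    The [rho^-1] of the zeroth-order rate has no probabilistic origin: it pays for a numerical
    constant left by the finite-difference remainder, through [1 / 2 <= rho / 4 + rho^-1 / 2]. *)

Section euclidean_theory.
Context {R : realType} {d : nat}.
Implicit Types (u v w x h : 'rV[R]_d) (a : R).

Lemma dotpC u v : dotp u v = dotp v u.
Proof. by apply: eq_bigr => i _; rewrite mulrC. Qed.

Lemma dotpDl u v w : dotp (u + v) w = dotp u w + dotp v w.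
Proof. by rewrite -big_split; apply: eq_bigr => i _; rewrite mxE mulrDl. Qed.

Lemma dotpZl a u w : dotp (a *: u) w = a * dotp u w.
Proof. by rewrite mulr_sumr; apply: eq_bigr => i _; rewrite mxE mulrA. Qed.

Lemma dotpNl u w : dotp (- u) w = - dotp u w.
Proof. by rewrite -scaleN1r dotpZl mulN1r. Qed.

Lemma dotpBl u v w : dotp (u - v) w = dotp u w - dotp v w.
Proof. by rewrite dotpDl dotpNl. Qed.

Lemma dotpZr a u w : dotp w (a *: u) = a * dotp w u.
Proof. by rewrite dotpC dotpZl (dotpC w). Qed.

Lemma dotpBr u v w : dotp w (u - v) = dotp w u - dotp w v.
Proof. by rewrite dotpC dotpBl !(dotpC w). Qed.

Lemma dotp_suml (I : Type) (r : seq I) (F : I -> 'rV[R]_d) w :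
  dotp (\sum_(i <- r) F i) w = \sum_(i <- r) dotp (F i) w.
Proof.
elim/big_rec2: _ => [|i y x _ <-]; last by rewrite dotpDl.
by rewrite /dotp big1// => i _; rewrite mxE mul0r.
Qed.

Lemma dotp_ge0 u : 0 <= dotp u u.
Proof. by apply: sumr_ge0 => i _; rewrite -expr2 sqr_ge0. Qed.

Lemma enorm_ge0 u : 0 <= enorm u.
Proof. exact: sqrtr_ge0. Qed.

Lemma enorm_sqr u : enorm u ^+ 2 = dotp u u.
Proof. exact/sqr_sqrtr/dotp_ge0. Qed.

Lemma enorm_eq0 u : enorm u = 0 -> u = 0.
Proof.
move=> u0; have := enorm_sqr u; rewrite u0 expr0n/= => /esym/eqP.
rewrite /dotp psumr_eq0 => [/allP uu0|i _]; last by rewrite -expr2 sqr_ge0.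
apply/rowP => i; rewrite mxE; apply/eqP.
by have := uu0 i (mem_index_enum i); rewrite mulf_eq0 orbb.
Qed.

Lemma enormZ a u : enorm (a *: u) = `|a| * enorm u.
Proof.
by rewrite /enorm dotpZl dotpZr mulrA -expr2 sqrtrM ?sqr_ge0// sqrtr_sqr.
Qed.

(** Cauchy-Schwarz: the square of [enorm v *: u - enorm u *: v] equals [2 * (p * q) * (p * q - c)],
    so its sign decides once both norms are positive. *)
Lemma dotp_le_enorm u v : dotp u v <= enorm u * enorm v.
Proof.
have [/enorm_eq0->|u0] := eqVneq (enorm u) 0.
  by rewrite /dotp big1 ?mulr_ge0 ?enorm_ge0// => i _; rewrite mxE mul0r.
have [/enorm_eq0->|v0] := eqVneq (enorm v) 0.
  by rewrite /dotp big1 ?mulr_ge0 ?enorm_ge0// => i _; rewrite mxE mulr0.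
have := dotp_ge0 (enorm v *: u - enorm u *: v).
rewrite !(dotpBl, dotpBr, dotpZl, dotpZr) -!enorm_sqr (dotpC v u).
set p := enorm u; set q := enorm v; set c := dotp u v.
have p0 : 0 < p by rewrite lt_neqAle eq_sym u0 enorm_ge0.
have q0 : 0 < q by rewrite lt_neqAle eq_sym v0 enorm_ge0.
rewrite [X in 0 <= X](_ : _ = 2 * (p * q) * (p * q - c)); last by ring.
by rewrite pmulr_rge0 ?subr_ge0// !mulr_gt0.
Qed.

Lemma normr_dotp_le_enorm u v : `|dotp u v| <= enorm u * enorm v.
Proof.
rewrite ler_norml dotp_le_enorm andbT lerNl -dotpNl.
by rewrite (le_trans (dotp_le_enorm _ _))// -scaleN1r enormZ normrN1 mul1r.
Qed.

Lemma delta_sum u : u = \sum_(i < d) u ord0 i *: delta_mx ord0 i.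
Proof. exact: row_sum_delta. Qed.

Lemma derive_dotp (f : 'rV[R]_d -> R) x h : differentiable f x ->
  'D_h f x = dotp (grad f x) h.
Proof.
move=> df; rewrite deriveE// {1}(delta_sum h) linear_sum /dotp.
apply: eq_bigr => i _; rewrite linearZ/= mxE deriveE// mulrC.
by [].
Qed.

Lemma is_derive_line (f : 'rV[R]_d -> R) x h (s : R) :
  differentiable f (x + s *: h) ->
  is_derive s 1 (fun s => f (x + s *: h)) (dotp (grad f (x + s *: h)) h).
Proof.
move=> df.
have dl : is_diff s (cst x + ( *:%R ^~ h)) (0 + ( *:%R ^~ h)) by exact: is_diffD.
case: dl => dl dlE.
have dfl : differentiable (f \o (cst x + ( *:%R ^~ h))) s.
  exact: differentiable_comp.
apply: DeriveDef; first exact: diff_derivable.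
rewrite deriveE// diff_comp//= dlE.
by rewrite !fctE add0r scale1r -deriveE// derive_dotp.
Qed.

(** The hypotheses concern only the segment, because [f] is smooth on [Omega] alone. The two-sided
    form serves the finite differences of the sample functions, whose error has no sign. *)
Lemma quadratic_bound (f : 'rV[R]_d -> R) (L : R) x h :
  (forall s : R, 0 <= s <= 1 -> differentiable f (x + s *: h)) ->
  (forall s : R, 0 <= s <= 1 ->
    enorm (grad f (x + s *: h) - grad f x) <= L * (s * enorm h)) ->
  `|f (x + h) - f x - dotp (grad f x) h| <= L / 2 * enorm h ^+ 2.
Proof.
move=> df gf.
(* Both signs of the absolute value are treated at once, as [c = 1] and [c = -1]. *)
suff key (c : R) : `|c| <= 1 ->
    c * (f (x + h) - f x - dotp (grad f x) h) <= L / 2 * enorm h ^+ 2.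
  rewrite ler_norml lerNl; apply/andP; split.
    by have := key (-1); rewrite mulN1r normrN1; exact.
  by have := key 1; rewrite mul1r normr1; exact.
move=> c1.
(* Subtracting the quadratic makes the derivative of [psi] nonpositive on the segment, so the mean
   value theorem replaces an integral of the gradient. *)
pose psi (s : R) := c * (f (x + s *: h) - s * dotp (grad f x) h)
  - L / 2 * s ^+ 2 * enorm h ^+ 2.
have dpsi (s : R) : 0 <= s <= 1 -> is_derive s 1 psi
    (c * (dotp (grad f (x + s *: h)) h - dotp (grad f x) h)
     - L * s * enorm h ^+ 2).
  move=> s01; have dl := is_derive_line (df s s01).
  apply: is_derive_eq.
  rewrite /= !scaler0 !add0r /GRing.scale/= !mulr1; by field.
have [t||t t01] := @MVT_segment R psi (fun s =>
    c * (dotp (grad f (x + s *: h)) h - dotp (grad f x) h)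
     - L * s * enorm h ^+ 2) 0 1 ler01.
- by rewrite in_itv/= => /andP[t0 t1]; apply: dpsi; rewrite !ltW.
- apply: derivable_within_continuous => t; rewrite in_itv/= => t01.
  by case: (dpsi t t01).
rewrite subr0 mulr1 /psi scale1r scale0r addr0 expr0n/= expr1n !mulr1 mulr0 mul0r.
rewrite subr0 mul1r mul0r subr0 => psiE.
suff : c * (f (x + h) - f x - dotp (grad f x) h) - L / 2 * enorm h ^+ 2 <= 0.
  by rewrite subr_le0.
rewrite [leLHS](_ : _ = c * (f (x + h) - dotp (grad f x) h) -
  L / 2 * enorm h ^+ 2 - c * f x); last by ring.
rewrite psiE subr_le0; apply: le_trans (ler_norm _) _.
rewrite normrM; apply: le_trans (ler_piMl _ c1) _ => //.
rewrite -dotpBl; apply: le_trans (normr_dotp_le_enorm _ _) _.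
rewrite expr2 mulrA ler_wpM2r ?enorm_ge0// -mulrA.
by apply: gf; move: t01; rewrite in_itv.
Qed.

(** By convexity every right difference quotient at [x] along [y - x] is at most [f y - f x]; the
    bound passes to their limit. *)
Lemma convex_gradient_le (f : 'rV[R]_d -> R) x y :
  convex_function setT f -> differentiable f x ->
  dotp (grad f x) (y - x) <= f y - f x.
Proof.
move=> cf df; pose h := y - x.
have df0 : differentiable f (x + 0 *: h) by rewrite scale0r addr0.
have [dl dlE] := is_derive_line df0.
rewrite scale0r addr0 in dlE; rewrite -dlE.
move/cvg_dnbhs_at_right: dl => /cvgr_to_le; apply.
near=> t.
have t01 : 0 <= t <= 1.
  by apply/andP; split; near: t; [exact: nbhs_right_ge|exact: nbhs_right_le].
have t0 : 0 < t by near: t; exact: nbhs_right_gt.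
rewrite /= scale0r addr0 addr0 [_%:A]mulr1.
rewrite [leLHS]mulrC ler_pdivrMr//.
case/andP: t01 => t0' t1.
have := cf (Itv01 t0' t1) y x; rewrite !inE => /(_ I I).
rewrite convRE /=.
have -> : conv (Itv01 t0' t1) (y : convex_lmodType _) x = x + t *: h.
  rewrite /conv/= /unstable.onem scalerBl scale1r /h scalerBr addrCA.
  by [].
by rewrite /unstable.onem mulrBl mul1r [(_ - _) * t]mulrC mulrBr; lra.
Unshelve. all: by end_near.
Qed.

Lemma convex_set_segment (Omega : set 'rV[R]_d) x y (s : R) : convex_set Omega ->
  Omega x -> Omega y -> 0 <= s <= 1 -> Omega (x + s *: (y - x)).
Proof.
move=> cO Ox Oy /andP[s0 s1].
have := cO y x (Itv01 s0 s1); rewrite !inE => /(_ Oy Ox).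
congr Omega; rewrite /conv/= /unstable.onem scalerBl scale1r scalerBr addrCA.
by [].
Qed.

(** Split [<grad f x, v - x>] as [<grad f x - g, v - xstar> + <g, v - xstar> + <grad f x, xstar -
    x>]. The second term is nonpositive by the choice of [v], and convexity bounds the third by
    [f xstar - f x]. The gradient error is thus paired with a vector of norm at most [D]. *)
Lemma frank_wolfe_step (L D gamma : R) (Omega : set 'rV[R]_d)
    (f : 'rV[R]_d -> R) xstar x g v : 0 <= L -> 0 <= gamma <= 1 ->
  convex_set Omega ->
  (forall x y, Omega x -> Omega y -> enorm (x - y) <= D) ->
  convex_function setT f ->
  (forall x, Omega x -> differentiable f x) ->
  (forall x y, Omega x -> Omega y ->
    enorm (grad f x - grad f y) <= L * enorm (x - y)) ->
  Omega xstar -> Omega x -> lmo_answer Omega g v ->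
  f (x + gamma *: (v - x)) - f xstar <= (1 - gamma) * (f x - f xstar)
    + gamma * dotp (grad f x - g) (v - xstar) + L / 2 * gamma ^+ 2 * D ^+ 2.
Proof.
move=> L0 /andP[g0 g1] cO dO cf df gf Os Ox [Ov vmin].
have seg (s : R) : 0 <= s <= 1 -> Omega (x + s *: (gamma *: (v - x))).
  move=> /andP[s0 s1]; rewrite scalerA; apply: convex_set_segment => //.
  by rewrite mulr_ge0//= mulr_ile1.
have /ler_normlP[_] : `|f (x + gamma *: (v - x)) - f x
    - dotp (grad f x) (gamma *: (v - x))| <= L / 2 * enorm (gamma *: (v - x)) ^+ 2.
  apply: quadratic_bound => [s /seg/df//|s s01].
  have /andP[s0 _] := s01.
  rewrite -{2}(ger0_norm s0) -enormZ.
  apply: le_trans (gf _ _ (seg _ s01) Ox) _.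
  by rewrite (addrC x) addrK.
rewrite enormZ ger0_norm// exprMn dotpZr => qb.
have cvx := convex_gradient_le xstar cf (df _ Ox).
have le_D : enorm (v - x) ^+ 2 <= D ^+ 2.
  by rewrite lerXn2r ?nnegrE ?enorm_ge0 ?dO// (le_trans (enorm_ge0 _) (dO _ _ Ov Ox)).
have := vmin _ Os.
rewrite !(dotpBl, dotpBr) in qb cvx *; rewrite (dotpC v) (dotpC xstar) => lm.
have : L / 2 * (gamma ^+ 2 * enorm (v - x) ^+ 2) <= L / 2 * (gamma ^+ 2 * D ^+ 2).
  by rewrite !ler_wpM2l ?divr_ge0 ?sqr_ge0.
have : gamma * (dotp g v - dotp g xstar) <= 0 by rewrite mulr_ge0_le0// subr_le0.
have : gamma * (dotp (grad f x) xstar - dotp (grad f x) x - (f xstar - f x)) <= 0.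
  by rewrite mulr_ge0_le0// subr_le0.
move: qb; lra.
Qed.

End euclidean_theory.

(** * Independence *)

Section measurable_rV_theory.
Context {disp dW : measure_display} {T : measurableType disp} {W : measurableType dW}.
Variable n : nat.

Lemma measurable_coord (i : 'I_n) :
  measurable_fun setT (fun x : 'rV[T]_n => x ord0 i).
Proof.
move=> _ A mA; apply: sub_sigma_algebra.
rewrite (bigD1 i)//=; left.
by exists A.
Qed.

Lemma measurable_fun_rV (D : set W) (X : W -> 'rV[T]_n) :
  (forall i, measurable_fun D (fun w => X w ord0 i)) -> measurable_fun D X.
Proof.
move=> mX mD.
apply: (@measurability _ _ _ _ _ _ (\big[setU/set0]_(i < n)
  preimage_set_system setT (fun x : 'rV[T]_n => x ord0 i) measurable)) => //.
move=> _ [B + <-].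
elim/big_ind: _ => [//|A1 A2 IH1 IH2 [|]|i _ [A mA <-]].
- exact: IH1.
- exact: IH2.
- by rewrite setTI -comp_preimage; exact: mX.
Qed.
End measurable_rV_theory.

Section packed_functions.
Context {d1 d2 : measure_display} {T1 : measurableType d1} {T2 : measurableType d2}.

Definition mfun_of (f : T1 -> T2) (mf : measurable_fun setT f) : {mfun T1 >-> T2} :=
  HB.pack f (isMeasurableFun.Build _ _ _ _ f mf).

End packed_functions.

(* The measure instance of [pushforward] takes a proof of measurability which
   unification cannot supply. *)
Definition pushforward_measure {d1 d2} {T1 : measurableType d1}
    {T2 : measurableType d2} {R : realFieldType} (m : {measure set T1 -> \bar R})
    (f : T1 -> T2) (mf : measurable_fun setT f) : {measure set T2 -> \bar R} :=
  measure_function_pushforward__canonical__measure_function_Measure m mf.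

Section rectangles.
Local Open Scope ereal_scope.
Context d1 d2 (T1 : measurableType d1) (T2 : measurableType d2) (R : realType).

(** Rectangles are stable under intersection and generate the product sigma-algebra; as [m1] is
    finite, the constant sequence [setT] can serve as the exhausting one. *)
Lemma finite_measure_rect_unique (m1 m2 : {measure set (T1 * T2) -> \bar R}) :
  m1 setT < +oo ->
  (forall A B, measurable A -> measurable B -> m1 (A `*` B) = m2 (A `*` B)) ->
  forall X, measurable X -> m1 X = m2 X.
Proof.
move=> m1oo m12 X mX.
pose C : set (set (T1 * T2)) := [set A `*` B | A in measurable & B in measurable].
apply: (measure_unique C (fun=> setT)) => //.
- by rewrite measurable_prod_measurableType.
- move=> _ _ [X1 mX1 [X2 mX2 <-]] [Y1 mY1 [Y2 mY2 <-]]; rewrite -setXI.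
  by exists (X1 `&` Y1); [exact: measurableI|exists (X2 `&` Y2) => //; exact: measurableI].
- by move=> _; exists setT => //; exists setT => //; rewrite setXTT.
- by rewrite bigcup_const.
- by move=> _ [A mA [B mB <-]]; exact: m12.
Qed.

End rectangles.

Section independence.
Local Open Scope ereal_scope.
Context {R : realType} {dW d1 d2 : measure_display} {W : measurableType dW}
  {T1 : measurableType d1} {T2 : measurableType d2}.
Variable P : probability W R.

Definition indep (X : W -> T1) (Y : W -> T2) := forall A B,
  measurable A -> measurable B ->
  P (X @^-1` A `&` Y @^-1` B) = P (X @^-1` A) * P (Y @^-1` B).

(** Both sides are finite measures of [C], so agreement on rectangles suffices. The constant [c]
    stands for the probability of an event independent of the pair. Usually [E'] is [setT]; a proper
    event [E'] lets a third variable be held fixed. *)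
Lemma pair_event_unique (X : W -> T1) (Y : W -> T2) (E E' : set W) (c : R) :
  (0 <= c)%R ->
  measurable_fun setT X -> measurable_fun setT Y -> measurable E -> measurable E' ->
  (forall A B, measurable A -> measurable B ->
    P (X @^-1` A `&` Y @^-1` B `&` E) = c%:E * P (X @^-1` A `&` Y @^-1` B `&` E')) ->
  forall C, measurable C ->
    P ((fun w => (X w, Y w)) @^-1` C `&` E) =
    c%:E * P ((fun w => (X w, Y w)) @^-1` C `&` E').
Proof.
move=> c0 mX mY mE mE' H C mC.
have mXY : measurable_fun setT (fun w => (X w, Y w)) by exact: measurable_fun_pair.
pose m1 := pushforward_measure (mrestr P mE) mXY.
pose m2 : {measure set (T1 * T2) -> \bar R} :=
  mscale (NngNum c0) (pushforward_measure (mrestr P mE') mXY).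
apply: (@finite_measure_rect_unique _ _ _ _ R m1 m2) => //.
rewrite [m1 _]/(P (setT `&` E)) setTI.
by rewrite (le_lt_trans (probability_le1 _ mE)) ?ltry.
Qed.

(** This takes the place of conditioning on [X]: independence identifies the joint law with the
    product of the laws, and Tonelli integrates [Y] out first. *)
Lemma ge0_integral_indep (X : {mfun W >-> T1}) (Y : {mfun W >-> T2})
    (h : T1 * T2 -> \bar R) :
  indep X Y -> measurable_fun setT h -> (forall z, 0 <= h z) ->
  \int[P]_w h (X w, Y w) = \int[P]_w \int[distribution P Y]_y h (X w, y).
Proof.
move=> iXY mh h0.
have mXY : measurable_fun setT (fun w => (X w, Y w)) by exact: measurable_fun_pair.
transitivity (\int[pushforward_measure P mXY]_z h z).
  by rewrite ge0_integral_pushforward.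
transitivity (\int[distribution P X \x distribution P Y]_z h z).
  apply: eq_measure_integral => A mA _; apply/esym.
  by apply: product_measure_unique => // B C mB mC; exact: iXY.
rewrite fubini_tonelli1// ge0_integral_distribution//.
- exact: measurable_fun_fubini_tonelli_F.
- by move=> x; exact: integral_ge0.
Qed.

Lemma integral_indep (X : {mfun W >-> T1}) (Y : {mfun W >-> T2})
    (h : T1 * T2 -> \bar R) :
  indep X Y -> measurable_fun setT h ->
  P.-integrable setT (fun w => h (X w, Y w)) ->
  \int[P]_w h (X w, Y w) = \int[P]_w \int[distribution P Y]_y h (X w, y).
Proof.
move=> iXY mh ih.
have mXY : measurable_fun setT (fun w => (X w, Y w)) by exact: measurable_fun_pair.
pose mu := (distribution P X \x distribution P Y)%E.
have muE A : measurable A -> pushforward_measure P mXY A = mu A.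
  by move=> mA; apply/esym/product_measure_unique => // B C mB mC; exact: iXY.
have imu : mu.-integrable setT h.
  apply/integrableP; split => //.
  rewrite (_ : \int[mu]_z `|h z| = \int[pushforward_measure P mXY]_z `|h z|).
    2: by apply: eq_measure_integral => A mA _; exact/esym/muE.
  rewrite ge0_integral_pushforward//; last exact: measurableT_comp.
  by move/integrableP : ih => [].
transitivity (\int[pushforward_measure P mXY]_z h z).
  by rewrite integral_pushforward.
transitivity (\int[mu]_z h z).
  by apply: eq_measure_integral => A mA _; exact: muE.
rewrite -integral12_prod_meas1//.
have iF := integrable_fubini_F imu.
rewrite integral_distribution//; first exact: measurable_fubini_F imu.
have /integrableP[mF Foo] := iF.
apply/integrableP; split; first exact: measurableT_comp.
rewrite ge0_integral_distribution// in Foo.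
exact: measurableT_comp.
Qed.

Lemma integral_indep_eq0 (X : {mfun W >-> T1}) (Y : {mfun W >-> T2})
    (h : T1 * T2 -> R) :
  indep X Y -> measurable_fun setT h ->
  P.-integrable setT (fun w => (h (X w, Y w))%:E) ->
  (forall w, \int[distribution P Y]_y (h (X w, y))%:E = 0) ->
  \int[P]_w (h (X w, Y w))%:E = 0.
Proof.
move=> iXY mh ih h0.
rewrite (@integral_indep _ _ (EFin \o h))//; last exact/measurable_EFinP.
by apply: integral0_eq => w _; exact: h0.
Qed.
End independence.

(** * Square integrability and the variance of a mini-batch *)

Section square_integrable.
Local Open Scope ereal_scope.
Context {R : realType} {dW : measure_display} {W : measurableType dW}.
Variable P : probability W R.

Lemma integrable_sqrM (a b : W -> R) :
  measurable_fun setT a -> measurable_fun setT b ->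
  \int[P]_w (a w ^+ 2)%:E < +oo -> \int[P]_w (b w ^+ 2)%:E < +oo ->
  P.-integrable setT (fun w => (a w * b w)%:E).
Proof.
move=> ma mb a2 b2.
have isq (c : W -> R) : measurable_fun setT c -> \int[P]_w (c w ^+ 2)%:E < +oo ->
    P.-integrable setT (fun w => (c w ^+ 2)%:E).
  move=> mc c2; apply/integrableP; split.
    by apply/measurable_EFinP; exact: measurable_funX.
  by under eq_integral do rewrite gee0_abs ?lee_fin ?sqr_ge0//.
apply: (@le_integrable _ _ _ P _ measurableT _ (fun w => (a w ^+ 2)%:E + (b w ^+ 2)%:E)).
- by apply/measurable_EFinP; exact: measurable_funM.
- move=> w _; rewrite -EFinD !abse_EFin lee_fin.
  rewrite [leRHS]ger0_norm ?addr_ge0 ?sqr_ge0// normrM.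
  rewrite -(real_normK (num_real (a w))) -(real_normK (num_real (b w))).
  have := sqr_ge0 (`|a w| - `|b w|)%R.
  have := mulr_ge0 (normr_ge0 (a w)) (normr_ge0 (b w)); rewrite sqrrB; lra.
- by apply: integrableD => //; exact: isq.
Qed.

Lemma integrable_sqr (a : W -> R) : measurable_fun setT a ->
  \int[P]_w (a w ^+ 2)%:E < +oo -> P.-integrable setT (fun w => (a w)%:E).
Proof.
move=> ma a2.
rewrite (_ : (fun w => _) = (fun w => (a w * cst 1 w)%:E))%R; last first.
  by apply/funext => w /=; rewrite mulr1.
apply: integrable_sqrM => //.
by rewrite /= integral_cst//= probability_setT expr1n mule1 ltry.
Qed.

End square_integrable.

Section minibatch.
Local Open Scope ereal_scope.
Context {R : realType} {dW dE dT : measure_display} {W : measurableType dW}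
  {E : measurableType dE} {T : measurableType dT}.
Variable P : probability W R.

(** With [X] frozen, the errors [h k] of distinct samples are centred and uncorrelated, so averaging
    divides the second moment by [b]. Centring and the bound [V] are required only at the points
    [X w]: gradients are controlled on [Omega], where the iterates stay. The bound is on the sum
    over coordinates because the assumptions bound a Euclidean norm. *)
Lemma minibatch_variance (b d : nat) (X : {mfun W >-> E}) (Z : 'I_b -> {mfun W >-> T})
    (h : 'I_d -> E * T -> R) (V : W -> R) :
  (0 < b)%N ->
  (forall k, measurable_fun setT (h k)) ->
  (forall j, indep P X (Z j)) ->
  (forall i j, i != j -> indep P (fun w => (X w, Z i w)) (Z j)) ->
  (forall k j w, \int[distribution P (Z j)]_y (h k (X w, y))%:E = 0) ->
  (forall j w, \sum_(k < d) \int[distribution P (Z j)]_y (h k (X w, y) ^+ 2)%:E <= (V w)%:E) ->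
  measurable_fun setT V -> \int[P]_w (V w)%:E < +oo ->
  \int[P]_w (\sum_(k < d) (b%:R^-1 * \sum_(j < b) h k (X w, Z j w)) ^+ 2)%:E
    <= (b%:R^-1)%:E * \int[P]_w (V w)%:E.
Proof.
move=> b0 mh iX iXZ h0 h2 mV Voo.
pose a k j w := h k (X w, Z j w).
have ma k j : measurable_fun setT (a k j).
  by apply: measurableT_comp => //; exact: measurable_fun_pair.
have mh2 k : measurable_fun setT (fun p => (h k p ^+ 2)%:E).
  by apply/measurable_EFinP; exact: measurable_funX.
have a2E k j : \int[P]_w (a k j w ^+ 2)%:E =
    \int[P]_w \int[distribution P (Z j)]_y (h k (X w, y) ^+ 2)%:E.
  rewrite (@ge0_integral_indep _ _ _ _ _ _ _ P X (Z j) (fun p => (h k p ^+ 2)%:E))//.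
  by move=> z; rewrite lee_fin sqr_ge0.
have V0 w : 0 <= (V w)%:E.
  apply: le_trans (h2 (Ordinal b0) w); apply: sume_ge0 => k _.
  by apply: integral_ge0 => y _; rewrite lee_fin sqr_ge0.
have mint k j : measurable_fun setT
    (fun w => \int[distribution P (Z j)]_y (h k (X w, y) ^+ 2)%:E).
  have := @measurable_fun_fubini_tonelli_F _ _ _ _ _ (distribution P (Z j))
    (fun p => (h k p ^+ 2)%:E) (mh2 k).
  have p0 z : 0 <= (h k z ^+ 2)%:E by rewrite lee_fin sqr_ge0.
  by move=> /(_ p0) mF; exact: (measurableT_comp mF).
have a2V j : \sum_(k < d) \int[P]_w (a k j w ^+ 2)%:E <= \int[P]_w (V w)%:E.
  under eq_bigr do rewrite a2E.
  rewrite -ge0_integral_sum//; last first.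
    by move=> k w _; apply: integral_ge0 => y _; rewrite lee_fin sqr_ge0.
  apply: ge0_le_integral => //.
  - move=> w _; apply: sume_ge0 => k _.
    by apply: integral_ge0 => y _; rewrite lee_fin sqr_ge0.
  - exact: emeasurable_sum.
  - exact/measurable_EFinP.
have a20 k j : 0 <= \int[P]_w (a k j w ^+ 2)%:E.
  by apply: integral_ge0 => y _; rewrite lee_fin sqr_ge0.
have a2oo k j : \int[P]_w (a k j w ^+ 2)%:E < +oo.
  apply: le_lt_trans Voo; apply: le_trans (a2V j).
  by rewrite (bigD1 k)//= leeDl// sume_ge0.
have iaa k i j : P.-integrable setT (fun w => (a k i w * a k j w)%:E).
  exact: integrable_sqrM.
(* Freezing the pair [(X, Z i)] makes the first factor a constant, and the second has mean zero
   under the law of [Z j]. *)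
have cross k i j : i != j -> \int[P]_w (a k i w * a k j w)%:E = 0.
  move=> ij.
  have mXZ : measurable_fun setT (fun w => (X w, Z i w)) by exact: measurable_fun_pair.
  apply: (@integral_indep_eq0 _ _ _ _ _ _ _ P (mfun_of mXZ) (Z j)
    (fun p => h k p.1 * h k (p.1.1, p.2))%R).
  - exact: iXZ.
  - apply: measurable_funM; first exact: measurableT_comp.
    apply: measurableT_comp => //; apply: measurable_fun_pair => //.
    exact: measurableT_comp.
  - exact: iaa.
  - move=> w /=; rewrite /=; under eq_integral do rewrite EFinM.
    rewrite integralZl//; first by rewrite h0 mule0.
    (* With [X w] frozen, integrability in the sample comes from its second moment, which is at most
       the real number [V w]. *)
    apply: integrable_sqr; first exact: measurableT_comp.
    apply: (@le_lt_trans _ _ (V w)%:E); last exact: ltry.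
    apply: le_trans (h2 j w).
    rewrite (bigD1 k)//= leeDl// sume_ge0// => l _.
    by apply: integral_ge0 => y _; rewrite lee_fin sqr_ge0.
pose c : R := (b%:R^-1)%R.
have c0 : (0 <= c)%R by rewrite invr_ge0.
have sumE k : \int[P]_w ((c * \sum_(j < b) a k j w) ^+ 2)%:E =
    (c ^+ 2)%:E * \sum_(j < b) \int[P]_w (a k j w ^+ 2)%:E.
  transitivity (\int[P]_w ((c ^+ 2)%:E *
      \sum_(i < b) \sum_(j < b) (a k i w * a k j w)%:E)).
    apply: eq_integral => w _; rewrite exprMn EFinM; congr (_ * _).
    rewrite expr2 mulr_suml -sumEFin; apply: eq_bigr => i _.
    by rewrite mulr_sumr -sumEFin.
  have isum i : P.-integrable setT (fun w => \sum_(j < b) (a k i w * a k j w)%:E).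
    by apply: integrable_sum => // j _; exact: iaa.
  rewrite integralZl//; last by apply: integrable_sum.
  congr (_ * _); rewrite integral_sum//; apply: eq_bigr => i _.
  rewrite integral_sum// (bigD1 i)//= big1 ?adde0.
    by apply: eq_integral => w _; rewrite expr2.
  by move=> j ji; rewrite cross// eq_sym.
under eq_integral do rewrite -sumEFin.
rewrite ge0_integral_sum//; last 2 first.
- move=> k; apply/measurable_EFinP; apply: measurable_funX.
  apply: measurable_funM => //; apply: measurable_sum => j; exact: ma.
- by move=> k w _; rewrite lee_fin sqr_ge0.
under eq_bigr do rewrite sumE.
rewrite -ge0_sume_distrr; last by move=> k _; exact: sume_ge0.
rewrite exchange_big/=.
apply: (@le_trans _ _ ((c ^+ 2)%:E * \sum_(j < b) \int[P]_w (V w)%:E)).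
  by rewrite lee_wpmul2l ?lee_fin ?sqr_ge0//; apply: lee_sum => j _; exact: a2V.
have /fineK <- : \int[P]_w (V w)%:E \is a fin_num.
  by rewrite ge0_fin_numE//; apply: integral_ge0 => w _; exact: V0.
rewrite sumEFin sumr_const card_ord -!EFinM lee_fin -mulr_natr.
rewrite (_ : c ^+ 2 * _ = c * b%:R * (c * fine (\int[P]_w (V w)%:E)))%R; last by ring.
by rewrite mulVf ?mul1r// pnatr_eq0 -lt0n.
Qed.
End minibatch.

(** * Gaussian moments *)

Section gaussian_moments.
Context {R : realType}.
Local Notation mu := (@lebesgue_measure R).
Local Notation phi := (@normal_pdf R 0 1).
Local Notation N01 := (normal_prob (0 : R) (1 : R)).

(** The Radon-Nikodym derivative of the normal law agrees almost everywhere with its density,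
    because both have the same integral over every measurable set. *)
Lemma ge0_integral_normal_prob (m s : R) (f : R -> \bar R) :
  measurable_fun setT f -> (forall x, 0 <= f x)%E ->
  (\int[normal_prob m s]_x f x = \int[mu]_x (f x * (normal_pdf m s x)%:E))%E.
Proof.
move=> mf f0.
have dom := normal_prob_dominates m s.
rewrite -(Radon_Nikodym_SigmaFinite.change_of_variables dom)//.
have iD := Radon_Nikodym_SigmaFinite.f_integrable dom.
apply: ae_eq_integral => //.
- by apply: emeasurable_funM => //; exact: measurable_int iD.
- by apply: emeasurable_funM => //; apply/measurable_EFinP; exact: measurable_normal_pdf.
- apply: ae_eqe_mul2l.
  apply: integral_ae_eq => //.
  + by apply/measurable_EFinP; exact: measurable_normal_pdf.
  + by move=> A _ mA; rewrite -Radon_Nikodym_SigmaFinite.f_integral.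
Qed.

Lemma phiE x : phi x = normal_peak 1 * expR (- x ^+ 2 / 2).
Proof.
by rewrite normal_pdfE ?oner_neq0// /normal_fun subr0 expr1n.
Qed.

Lemma is_derive_phi (x : R) : is_derive x 1 phi (- x * phi x).
Proof.
rewrite (_ : normal_pdf 0 1 = fun x => normal_peak 1 * expR (- x ^+ 2 / 2)); last first.
  by apply/funext => y; exact: phiE.
apply: is_derive_eq; rewrite /GRing.scale/=.
by field.
Qed.

Lemma continuous_phi : continuous phi.
Proof. exact: continuous_normal_pdf (oner_neq0 _). Qed.

Lemma phi_even x : phi (- x) = phi x.
Proof. by rewrite !phiE sqrrN. Qed.

(** The boundary term of the second moment must vanish in the limit. From [1 + y <= expR y] at
    [y = n ^ 2 / 2] one gets [n ^ 2 * expR (- n ^ 2 / 2) <= 2], hence a bound by a multiple of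
    [1 / (n + 1)]. *)
Lemma gaussian_tail_cvg0 : (n%:R : R) * phi n%:R @[n --> \oo] --> (0 : R).
Proof.
pose p : R := normal_peak 1.
have p0 : 0 <= p by exact: normal_peak_ge0.
apply: (@squeeze_cvgr _ _ _ _ (cst 0) (fun n : nat => (2 * p * 2) * n.+1%:R^-1)).
- near=> n.
  have n1 : 1 <= n%:R :> R.
    by rewrite ler1n; near: n; exact: nbhs_infty_ge.
  rewrite mulr_ge0 ?normal_pdf_ge0 ?ler0n//= phiE -/p.
  have n0 : 0 < n%:R :> R by rewrite (lt_le_trans _ n1).
  have e1 : 0 < expR (- n%:R ^+ 2 / 2) :> R by exact: expR_gt0.
  have e2 : 1 + n%:R ^+ 2 / 2 <= expR (n%:R ^+ 2 / 2) :> R by exact: expR_ge1Dx.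
  have e3 : expR (- n%:R ^+ 2 / 2) * expR (n%:R ^+ 2 / 2) = 1 :> R.
    by rewrite -expRD mulNr addNr expR0.
  set E := expR (- n%:R ^+ 2 / 2) in e1 e3 *.
  have e4 : E * (n%:R ^+ 2 / 2) <= 1.
    rewrite -[leRHS]e3 ler_pM2l//; by apply: (le_trans _ e2); rewrite lerDr.
  rewrite ler_pdivlMr ?ltr0n//.
  have -> : n%:R * (p * E) * n.+1%:R = p * (E * (n%:R * n.+1%:R)) by ring.
  have -> : 2 * p * 2 = p * 4 by ring.
  apply: ler_wpM2l => //; rewrite -natr1.
  have : n%:R * (n%:R + 1) <= 2 * n%:R ^+ 2 :> R by nra.
  by move=> /(ler_wpM2l (ltW e1)); lra.
- exact: cvg_cst.
- rewrite -(mulr0 (2 * p * 2)); apply: cvgMl_tmp.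
  exact: cvg_harmonic.
Unshelve. all: by end_near.
Qed.

Lemma ge0_integral_oppr (f : R -> \bar R) : measurable_fun [set: R] f ->
  (forall x, 0 <= f x)%E -> (\int[mu]_x f x = \int[mu]_x f (- x)%R)%E.
Proof.
move=> mf f0.
have mN : measurable_fun setT (-%R : measurableTypeR R -> measurableTypeR R).
  by apply: continuous_measurable_fun; exact: opp_continuous.
transitivity (\int[pushforward_measure mu mN]_x f x)%E.
  by apply: eq_measure_integral => A mA _; exact/esym/lebesgue_measureN.
by rewrite ge0_integral_pushforward.
Qed.

(** Integrate by parts with [x ^+ m.+1] and [- phi], whose derivative is [x * phi x]. The boundary
    term stands on the left, so no subtraction of extended reals occurs, and its sign alone gives an
    inequality. *)
Lemma gaussian_by_parts (m : nat) (k : R) : 0 < k ->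
  (\int[mu]_(x in `[0%R, k]) (x ^+ m.+2 * phi x)%:E + (k ^+ m.+1 * phi k)%:E =
   m.+1%:R%:E * \int[mu]_(x in `[0%R, k]) (x ^+ m * phi x)%:E)%E.
Proof.
move=> k0.
have cX n : continuous (fun x : R => x ^+ n) by exact: exprn_continuous.
have dX n (x : R) : is_derive x 1 (fun x : R => x ^+ n.+1) (n.+1%:R * x ^+ n).
  apply: DeriveDef; first exact: exprn_derivable.
  by rewrite exp_derive /GRing.scale/= mulr1.
have dN (x : R) : is_derive x 1 (fun x : R => - phi x) (x * phi x).
  by have := is_derive_phi x => ?; apply: is_derive_eq; rewrite mulNr opprK.
have LR (F f : R -> R) : (forall x : R, is_derive x 1 F (f x)) ->
    derivable_oo_LRcontinuous F 0 k.
  move=> dF; have cF : continuous F.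
    move=> x; apply: differentiable_continuous; apply/derivable1_diffP.
    by case: (dF x).
  split => [x _||]; first by case: (dF x).
    exact/cvg_at_right_filter/cF.
  exact/cvg_at_left_filter/cF.
have := @integration_by_parts R (fun x => x ^+ m.+1) (fun x => - phi x)
  (fun x => m.+1%:R * x ^+ m) (fun x => x * phi x) 0 k k0.
have cP := continuous_phi.
move=> /(_ _ (LR _ _ (dX m)) _ _ (LR _ _ dN)).
have c1 : {within `[0, k], continuous (fun x : R => m.+1%:R * x ^+ m)}.
  apply: continuous_subspaceT => x; apply: cvgM; [exact: cvg_cst|exact: cX].
have c2 : {within `[0, k], continuous (fun x : R => x * phi x)}.
  apply: continuous_subspaceT => x; apply: cvgM; [exact: cvg_id|exact: cP].
move=> /(_ c1 _ c2) H.
have ik : mu.-integrable `[0%R, k] (fun x => (x ^+ m * phi x)%:E).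
  apply: continuous_compact_integrable; first exact: segment_compact.
  apply: continuous_subspaceT => x; apply: cvgM; [exact: cX|exact: cP].
rewrite (_ : \int[mu]_(x in `[0%R, k]) (x ^+ m.+2 * phi x)%:E =
    \int[mu]_(x in `[0%R, k]) (x ^+ m.+1 * (x * phi x))%:E)%E; last first.
  by apply: eq_integral => x _; rewrite exprSr mulrA.
rewrite {}H; last 2 first.
- by move=> x _; rewrite derive1E; case: (dX m x).
- by move=> x _; rewrite derive1E; case: (dN x).
rewrite (_ : \int[mu]_(x in `[0%R, k]) (m.+1%:R * x ^+ m * - phi x)%:E =
    (- m.+1%:R)%:E * \int[mu]_(x in `[0%R, k]) (x ^+ m * phi x)%:E)%E; last first.
  rewrite -integralZl//; apply: eq_integral => x _.
  by rewrite -EFinM mulrN mulNr mulrA.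
have /fineK <- : (\int[mu]_(x in `[0%R, k]) (x ^+ m * phi x)%:E)%E \is a fin_num.
  by apply: integrable_fin_num.
rewrite -!EFinM -EFinB -EFinD; congr EFin.
by rewrite expr0n/= mul0r subr0; ring.
Qed.

(** The half-line is exhausted by the segments on which integration by parts is done; by symmetry an
    even moment is twice this value. *)
Definition half_moment (m : nat) : \bar R :=
  (\int[mu]_(x in `[0%R, +oo[) (x ^+ m * phi x)%:E)%E.

Lemma even_moment_ge0 (m : nat) (x : R) : ~~ odd m -> 0 <= x ^+ m * phi x.
Proof.
move=> om; apply: mulr_ge0; [exact: exprn_even_ge0|exact: normal_pdf_ge0].
Qed.

Lemma continuous_moment (m : nat) : continuous (fun x : R => x ^+ m * phi x).
Proof. by move=> x; apply: cvgM; [exact: exprn_continuous|exact: continuous_phi]. Qed.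

Lemma measurable_moment (m : nat) : measurable_fun setT (fun x : R => x ^+ m * phi x).
Proof. by apply: continuous_measurable_fun; exact: continuous_moment. Qed.

Lemma half_momentS_le (m : nat) : ~~ odd m ->
  (half_moment m.+2 <= m.+1%:R%:E * half_moment m)%E.
Proof.
move=> om; have om2 : ~~ odd m.+2 by rewrite /= negbK.
rewrite {1}/half_moment ge0_integral_ereal_sup; last 2 first.
- by move=> x; exact: even_moment_ge0.
- exact: measurable_moment.
apply: ge_ereal_sup => _ [n _ <-].
have n0 : 0 < n.+1%:R :> R by [].
have := gaussian_by_parts m n0 => E.
apply: (@le_trans _ _ (m.+1%:R%:E * \int[mu]_(x in `[0%R, n.+1%:R]) (x ^+ m * phi x)%:E)%E).
  by rewrite -E leeDl// lee_fin mulr_ge0// normal_pdf_ge0.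
rewrite lee_wpmul2l ?lee_fin//; apply: ge0_subset_integral => //=.
- by apply/measurable_EFinP; apply: measurable_funTS; exact: measurable_moment.
- by move=> x _; rewrite lee_fin even_moment_ge0.
- exact: subset_itvl.
Qed.

(** An equality is needed here, unlike for the fourth and sixth moments: the variance must be
    exactly 1 for the gradient estimator to be unbiased. *)
Lemma half_moment2 : (half_moment 2 = half_moment 0)%E.
Proof.
have cvg m : ~~ odd m -> ((\int[mu]_(x in `[0%R, n%:R]) (x ^+ m * phi x)%:E)%E
    @[n --> \oo] --> half_moment m)%E.
  move=> om; apply: ge0_cvgn_integral; last exact: measurable_moment.
  by move=> x; exact: even_moment_ge0.
have c0 : (((n%:R : R) * phi n%:R)%:E @[n --> \oo] --> 0)%E.
  by apply: cvg_EFin; [exact: nearW|exact: gaussian_tail_cvg0].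
have c2 := cvgeD (fin_num_adde_defl _ _) (cvg 2 isT) c0.
rewrite adde0 in c2.
have c2' := c2 _ isT.
have : (\int[mu]_(x in `[0%R, n%:R]) (x ^+ 0 * phi x)%:E)%E
    @[n --> \oo] --> half_moment 2.
  apply: cvg_trans (c2' _); apply: near_eq_cvg; near=> n.
  have n0 : 0 < n%:R :> R by rewrite ltr0n; near: n; exact: nbhs_infty_gt.
  by have := gaussian_by_parts 0 n0; rewrite expr1 mul1e.
by move=> /cvg_lim <- //; apply/cvg_lim => //; exact: cvg.
Unshelve. all: by end_near.
Qed.

Lemma moment_even (m : nat) : ~~ odd m ->
  (\int[N01]_x (x ^+ m)%:E = 2%:E * half_moment m)%E.
Proof.
move=> om; rewrite ge0_integral_normal_prob.
- under eq_integral do rewrite -EFinM.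
  rewrite ge0_symfun_integralT.
  + by rewrite -set_itvcy.
  + by move=> x; exact: even_moment_ge0.
  + exact: continuous_moment.
  + move=> x /=; rewrite phi_even -[m in RHS]even_halfK// -mul2n !exprM sqrrN.
    by rewrite -!exprM mul2n even_halfK.
- by apply/measurable_EFinP; apply: measurable_funX.
- by move=> x; rewrite lee_fin exprn_even_ge0.
Qed.

Lemma normal_moment2 : (\int[N01]_x (x ^+ 2)%:E = 1)%E.
Proof.
rewrite moment_even// half_moment2 -moment_even//.
under eq_integral do rewrite expr0.
by rewrite integral_cst//= mul1e probability_setT.
Qed.

Lemma normal_moment4_le : (\int[N01]_x (x ^+ 4)%:E <= 3%:E)%E.
Proof.
rewrite moment_even//.
apply: (@le_trans _ _ (2%:E * (3%:E * half_moment 2))%E).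
  by rewrite lee_wpmul2l// half_momentS_le.
by rewrite muleCA -moment_even// normal_moment2 mule1.
Qed.

Lemma normal_moment6_le : (\int[N01]_x (x ^+ 6)%:E <= 15%:E)%E.
Proof.
rewrite moment_even//.
apply: (@le_trans _ _ (2%:E * (5%:E * half_moment 4))%E).
  by rewrite lee_wpmul2l// half_momentS_le.
rewrite muleCA -moment_even//.
apply: (@le_trans _ _ (5%:E * 3%:E)%E).
  by rewrite lee_wpmul2l// normal_moment4_le.
by rewrite -EFinM lee_fin -natrM.
Qed.

(** The positive and negative parts have equal integrals by symmetry; they may be subtracted because
    [Num.max x 0 <= 1 + x ^+ 2] makes them finite. *)
Lemma normal_mean0 : (\int[N01]_x x%:E = 0)%E.
Proof.
have mM : measurable_fun setT (fun x : R => Num.max x 0).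
  by apply: measurable_maxr.
have mM' : measurable_fun setT (fun x : R => Num.max (- x) 0).
  by apply: measurable_maxr.
have mX2 : measurable_fun setT (fun x : R => x ^+ 2) by exact: measurable_funX.
have M0 (x : R) : 0 <= Num.max x 0 by rewrite le_max lexx orbT.
have p0 x : 0 <= phi x by exact: normal_pdf_ge0.
have pE : (\int[N01]_x (Num.max x 0)%:E = \int[N01]_x (Num.max (- x) 0)%:E)%E.
  have dens (f : R -> R) : measurable_fun setT f -> (forall x, 0 <= f x) ->
      (\int[N01]_x (f x)%:E = \int[mu]_x (f x * phi x)%:E)%E.
    by move=> mf f0; rewrite ge0_integral_normal_prob//; apply/measurable_EFinP.
  rewrite !dens//.
  rewrite ge0_integral_oppr.
  - by apply: eq_integral => x _; rewrite phi_even.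
  - apply/measurable_EFinP; apply: measurable_funM => //.
    by apply: continuous_measurable_fun; exact: continuous_phi.
  - by move=> x; rewrite lee_fin mulr_ge0.
rewrite integralE.
rewrite (_ : \int[N01]_x _ = \int[N01]_x (Num.max x 0)%:E)%E; last first.
  by apply: eq_integral => x _; rewrite funeposE -EFin_max.
rewrite (_ : \int[N01]_x (funeneg _ x) = \int[N01]_x (Num.max x 0)%:E)%E; last first.
  by rewrite pE; apply: eq_integral => x _; rewrite funenegE -EFinN -EFin_max.
rewrite subee// ge0_fin_numE; last by apply: integral_ge0 => x _; rewrite lee_fin.
apply: (@le_lt_trans _ _ (\int[N01]_x (1%:E + (x ^+ 2)%:E))%E).
  apply: ge0_le_integral => //.
  - by move=> x _; rewrite lee_fin.
  - exact/measurable_EFinP.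
  - by apply: emeasurable_funD => //; exact/measurable_EFinP.
  - move=> x _; rewrite -EFinD lee_fin /= ge_max; nra.
rewrite ge0_integralD//.
- by rewrite normal_moment2 integral_cst//= probability_setT mule1 -EFinD ltry.
- by move=> x _; rewrite lee_fin sqr_ge0.
- exact/measurable_EFinP.
Qed.

End gaussian_moments.

(** The product in the proof is twice [x ^+ 3 + y ^+ 3 + z ^+ 3 - 3 * x * y * z]. *)
Lemma amgm3 {R : realFieldType} (x y z : R) : 0 <= x -> 0 <= y -> 0 <= z ->
  x * y * z <= (x ^+ 3 + y ^+ 3 + z ^+ 3) / 3.
Proof.
move=> x0 y0 z0.
have : 0 <= (x + y + z) * ((x - y) ^+ 2 + (y - z) ^+ 2 + (z - x) ^+ 2).
  by rewrite mulr_ge0 ?addr_ge0 ?sqr_ge0.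
lra.
Qed.

Lemma measurable_dotp {R : realType} {d : nat} {dW : measure_display}
    {W : measurableType dW} (X Y : W -> 'rV[R]_d) :
  measurable_fun setT X -> measurable_fun setT Y ->
  measurable_fun setT (fun w => dotp (X w) (Y w)).
Proof.
move=> mX mY; apply: measurable_sum => i; apply: measurable_funM.
- exact: (measurableT_comp (measurable_coord i) mX).
- exact: (measurableT_comp (measurable_coord i) mY).
Qed.

Lemma measurable_enorm {R : realType} {d : nat} :
  measurable_fun setT (@enorm R d).
Proof.
have ms : measurable_fun setT (@Num.sqrt R).
  by apply: continuous_measurable_fun; exact: sqrt_continuous.
by apply: (measurableT_comp ms); apply: measurable_dotp; exact: measurable_id.
Qed.

(** * Moments of a standard Gaussian vector *)

Section gaussian_vector.
Context {R : realType} {dW : measure_display} {W : measurableType dW}.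
Variables (P : probability W R) (d : nat) (u : {RV P >-> 'rV[R]_d}).
Hypothesis gu : std_gaussian u.
Local Notation N01 := (normal_prob (0 : R) (1 : R)).

Let c (i : 'I_d) (w : W) : R := u w ord0 i.

Let mc i : measurable_fun setT (c i).
Proof. by apply: (measurableT_comp (measurable_coord i)). Qed.

(** The indices [k] and [i] may coincide, which yields pairwise independence as well; for this
    reason the box [D] intersects one constraint per index instead of choosing one by cases. *)
Let event3 (k i l : 'I_d) (A B C : set R) :
  measurable A -> measurable B -> measurable C -> k != l -> i != l ->
  P (c k @^-1` A `&` c i @^-1` B `&` c l @^-1` C) =
  (N01 C * P (c k @^-1` A `&` c i @^-1` B))%E.
Proof.
move=> mA mB mC kl il.
pose D C' j := (if j == k then A else setT) `&` (if j == i then B else setT)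
  `&` (if j == l then C' else setT).
have DE C' : [set w | forall j, D C' j (u w ord0 j)] =
    c k @^-1` A `&` c i @^-1` B `&` c l @^-1` C'.
  apply/seteqP; split => w /=.
    move=> H; split; first split.
    - by have [[+ _] _] := H k; rewrite eqxx.
    - by have [[_ +] _] := H i; rewrite eqxx.
    - by have [_ +] := H l; rewrite eqxx.
  move=> [[Hk Hi] Hl] j; split; first split.
  - by case: eqP => // ->.
  - by case: eqP => // ->.
  - by case: eqP => // ->.
have mD C' : measurable C' -> forall j, measurable (D C' j).
  by move=> mC' j; do 2?apply: measurableI; case: ifP.
rewrite -DE (gu (mD C mC)) -(setIT (c k @^-1` A `&` _)).
have := DE setT; rewrite preimage_setT => <-; rewrite (gu (mD setT measurableT)).
(* The boxes for [C] and for [setT] differ only in coordinate [l], so their products differ only in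
   that factor. *)
rewrite (bigD1 l)//= [in RHS](bigD1 l)//=.
have -> : D C l = C by rewrite /D eqxx eq_sym (negbTE kl) eq_sym (negbTE il) !setTI.
have -> : D setT l = setT.
  by rewrite /D eqxx eq_sym (negbTE kl) eq_sym (negbTE il) !setTI.
rewrite probability_setT mul1e; congr (_ * _)%E.
by apply: eq_bigr => j jl; rewrite /D (negbTE jl).
Qed.

Let law (i : 'I_d) (A : set R) : measurable A -> P (c i @^-1` A) = N01 A.
Proof.
move=> mA.
pose B j := if j == i then A else setT.
have -> : c i @^-1` A = [set w | forall j, B j (u w ord0 j)].
  apply/seteqP; split => w /=; last by move=> /(_ i); rewrite /B eqxx.
  by move=> Ai j; rewrite /B; case: eqP => // ->.
rewrite gu; last by move=> j; rewrite /B; case: ifP.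
rewrite (bigD1 i)//= big1 /B ?eqxx ?mule1// => j /negbTE ->.
by rewrite probability_setT.
Qed.

Let indep3 (k i l : 'I_d) : k != l -> i != l ->
  indep P (fun w => (c k w, c i w)) (c l).
Proof.
move=> kl il A C mA mC.
have c0 : 0 <= fine (N01 C) by rewrite fine_ge0.
have mC' : measurable (c l @^-1` C) by rewrite -[X in measurable X]setTI; exact: mc.
rewrite (@pair_event_unique _ _ _ _ _ _ _ P (c k) (c i) (c l @^-1` C) setT
  (fine (N01 C)) c0 (mc k) (mc i) mC' measurableT _ A mA).
  by rewrite setIT law// muleC fineK// fin_num_measure.
by move=> A1 B1 mA1 mB1; rewrite setIT event3// fineK// fin_num_measure.
Qed.

Let indep2 (k l : 'I_d) : k != l -> indep P (c k) (c l).
Proof.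
move=> kl A C mA mC.
have := event3 mA mA mC kl kl; rewrite setIid => ->.
by rewrite law// muleC law.
Qed.

Let cf i : {mfun W >-> R} := mfun_of (mc i).

Let mcR i : measurable_fun setT (c i : W -> measurableTypeR R).
Proof. exact: mc. Qed.

(* [normal_prob] lives on [measurableTypeR R], whose measure display is not the
   one of [R]. *)
Let cfR i : {mfun W >-> measurableTypeR R} := mfun_of (mcR i).

Let integral_law i (f : measurableTypeR R -> \bar R) : measurable_fun setT f ->
  (forall x, 0 <= f x)%E -> (\int[P]_w f (c i w) = \int[N01]_x f x)%E.
Proof.
move=> mf f0.
rewrite -[LHS](@ge0_integral_distribution _ _ _ _ _ P (cfR i))//.
by apply: eq_measure_integral => A mA _; exact: law.
Qed.

Let mX n : measurable_fun setT (fun x : R => x ^+ n).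
Proof. exact: measurable_funX. Qed.

Let moment2 i : (\int[P]_w (c i w ^+ 2)%:E = 1)%E.
Proof.
rewrite -normal_moment2 -(integral_law i)//; first exact/measurable_EFinP.
by move=> x; rewrite lee_fin sqr_ge0.
Qed.

Let moment4 i : (\int[P]_w (c i w ^+ 4)%:E <= 3%:E)%E.
Proof.
apply: le_trans normal_moment4_le; rewrite -(integral_law i)//.
  exact/measurable_EFinP.
by move=> x; rewrite lee_fin exprn_even_ge0.
Qed.

Let moment6 i : (\int[P]_w (c i w ^+ 6)%:E <= 15%:E)%E.
Proof.
apply: le_trans normal_moment6_le; rewrite -(integral_law i)//.
  exact/measurable_EFinP.
by move=> x; rewrite lee_fin exprn_even_ge0.
Qed.

Let c2oo i : (\int[P]_w (c i w ^+ 2)%:E < +oo)%E.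
Proof. by rewrite moment2 ltry. Qed.

Let moment22_lty k i : (\int[P]_w ((c k w * c i w) ^+ 2)%:E < +oo)%E.
Proof.
apply: (@le_lt_trans _ _ (\int[P]_w ((c k w ^+ 4)%:E + (c i w ^+ 4)%:E))%E).
  apply: ge0_le_integral => //.
  - by move=> w _; rewrite lee_fin sqr_ge0.
  - apply/measurable_EFinP; apply: measurable_funX; exact: measurable_funM.
  - by apply: emeasurable_funD; apply/measurable_EFinP; exact: measurable_funX.
  - move=> w _; rewrite -EFinD lee_fin.
    have := sqr_ge0 (c k w ^+ 2 - c i w ^+ 2).
    have := sqr_ge0 (c k w ^+ 2 + c i w ^+ 2); nra.
rewrite ge0_integralD//.
- by rewrite (le_lt_trans (leeD (moment4 k) (moment4 i)))// -EFinD ltry.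
- by move=> w _; rewrite lee_fin exprn_even_ge0.
- by apply/measurable_EFinP; exact: measurable_funX.
- by move=> w _; rewrite lee_fin exprn_even_ge0.
- by apply/measurable_EFinP; exact: measurable_funX.
Qed.

Let dist_mean0 l : (\int[distribution P (cf l)]_x x%:E = 0)%E.
Proof.
have ic : P.-integrable setT (fun w => (c l w)%:E) by exact: integrable_sqr.
rewrite (@integral_distribution _ _ _ _ _ P (cf l))//.
rewrite -[LHS](@integral_distribution _ _ _ _ _ P (cfR l) (fun x => x%:E))//.
  by rewrite -normal_mean0; apply: eq_measure_integral => A mA _; exact: law.
by move=> mD Y mY; exact: (EFin_measurable (D := setT) mD mY).
Qed.

Let dist_sqr_lty l : (\int[distribution P (cf l)]_x (x ^+ 2)%:E < +oo)%E.
Proof.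
rewrite ge0_integral_distribution.
- exact: c2oo.
- by apply/measurable_EFinP; exact: mX.
- by move=> x; rewrite lee_fin sqr_ge0.
Qed.

(** The identity covariance is what makes [<a, u> u] an unbiased estimate of [a]. *)
Lemma gaussian_covariance i k : P.-integrable setT (fun w => (u w ord0 i * u w ord0 k)%:E) /\
  (\int[P]_w (u w ord0 i * u w ord0 k)%:E = (i == k)%:R%:E)%E.
Proof.
have iik : P.-integrable setT (fun w => (c i w * c k w)%:E).
  exact: integrable_sqrM.
split=> //; case: eqVneq => [->|ik].
  by rewrite -(moment2 k); apply: eq_integral => w _; rewrite expr2.
apply: (@integral_indep_eq0 _ _ _ _ _ _ _ P (cf i) (cf k) (fun p => p.1 * p.2)) => //.
- exact: indep2.
- exact: measurable_funM.
- move=> w; under eq_integral do rewrite EFinM.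
  rewrite integralZl//; first by rewrite dist_mean0 mule0.
  by apply: integrable_sqr; [exact: measurable_id|exact: dist_sqr_lty].
Qed.

Let fourth_integrable k i l :
  P.-integrable setT (fun w => (c k w ^+ 2 * (c i w * c l w))%:E).
Proof.
rewrite (_ : (fun w => _) = (fun w => ((c k w * c i w) * (c k w * c l w))%:E)).
  by apply: integrable_sqrM => //; exact: measurable_funM.
by apply/funext => w; congr EFin; ring.
Qed.

Let fourth_offdiag k i l : i != l ->
  (\int[P]_w (c k w ^+ 2 * (c i w * c l w))%:E = 0)%E.
Proof.
(* As [i] and [l] differ, [k] differs from one of them, and the integrand is symmetric in the two.
   The coordinate [l] is then centred and independent of the pair of coordinates [k] and [i]. *)
wlog kl : i l / k != l => [H il|il].
  have [kl|/H] := eqVneq k l; last exact.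
  rewrite -(H l i) ?kl 1?eq_sym//.
  by apply: eq_integral => w _; rewrite (mulrC (c i w)).
have mki : measurable_fun setT (fun w => (c k w, c i w)) by exact: measurable_fun_pair.
rewrite -(@integral_indep_eq0 _ _ _ _ _ _ _ P (mfun_of mki) (cf l) (fun p => p.1.1 ^+ 2 * p.1.2 * p.2)).
- by apply: eq_integral => w _ /=; rewrite mulrA.
- exact: indep3.
- apply: measurable_funM => //; apply: measurable_funM.
    by apply: measurable_funX; exact: measurableT_comp.
  exact: measurableT_comp.
- by rewrite /=; under eq_fun do rewrite -mulrA; exact: fourth_integrable.
- move=> w; rewrite /=; under eq_integral do rewrite EFinM.
  rewrite integralZl//; first by rewrite dist_mean0 mule0.
  by apply: integrable_sqr; [exact: measurable_id|exact: dist_sqr_lty].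
Qed.

Let fourth_diag k i :
  (\int[P]_w (c k w ^+ 2 * (c i w * c i w))%:E <= (1 + 2 * (k == i)%:R)%:E)%E.
Proof.
case: eqVneq => [->|ki].
  rewrite (_ : \int[P]_w _ = \int[P]_w (c i w ^+ 4)%:E)%E.
    by apply: le_trans (moment4 i) _; rewrite lee_fin (_ : true%:R = 1)//; lra.
  by apply: eq_integral => w _; congr EFin; ring.
rewrite mulr0 addr0.
pose h (p : R * R) : \bar R := (p.1 ^+ 2 * p.2 ^+ 2)%:E.
have mh : measurable_fun setT h.
  by apply/measurable_EFinP; apply: measurable_funM; apply: measurable_funX.
have h0 p : (0 <= h p)%E by rewrite lee_fin mulr_ge0 ?sqr_ge0.
rewrite (_ : \int[P]_w _ = \int[P]_w h (cf k w, cf i w))%E; last first.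
  by apply: eq_integral => w _; rewrite /h/= [c i w ^+ 2]expr2.
rewrite ge0_integral_indep//; last exact: indep2.
rewrite -[leRHS](moment2 k) le_eqVlt; apply/orP; left; apply/eqP.
apply: eq_integral => w _.
rewrite /h/=; under eq_integral do rewrite EFinM.
rewrite ge0_integralZl//; first last.
- by rewrite lee_fin sqr_ge0.
- by move=> x _; rewrite lee_fin sqr_ge0.
- by apply/measurable_EFinP; exact: mX.
rewrite ge0_integral_distribution; first by rewrite moment2 mule1.
- by apply/measurable_EFinP; exact: mX.
- by move=> x; rewrite lee_fin sqr_ge0.
Qed.

(** The sum is [<a, u> ^ 2 * |u| ^ 2]. After expansion only the terms with [i = l] survive, and
    [a_i ^ 2] collects [1 + 2 * (k == i)] over all [k], that is [d + 2]. *)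
Lemma gaussian_fourth_moment (a : 'rV[R]_d) :
  (\int[P]_w (\sum_(k < d) (dotp a (u w) * u w ord0 k) ^+ 2)%:E
     <= ((d%:R + 2) * enorm a ^+ 2)%:E)%E.
Proof.
pose t k i l w : \bar R := (a ord0 i * a ord0 l * (c k w ^+ 2 * (c i w * c l w)))%:E.
have it k i l : P.-integrable setT (t k i l).
  rewrite /t; under eq_fun do rewrite EFinM.
  by apply: integrableZl => //; exact: fourth_integrable.
have tE w : (\sum_(k < d) (dotp a (u w) * u w ord0 k) ^+ 2)%:E
    = (\sum_(k < d) \sum_(i < d) \sum_(l < d) t k i l w)%E.
  rewrite -sumEFin; apply: eq_bigr => k _.
  rewrite exprMn expr2 /dotp !mulr_suml -sumEFin; apply: eq_bigr => i _.
  rewrite mulr_sumr mulr_suml -sumEFin; apply: eq_bigr => l _.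
  by rewrite /t /c; congr EFin; ring.
under eq_integral do rewrite tE.
rewrite integral_sum//; last first.
  by move=> k; apply: integrable_sum => // i _; apply: integrable_sum.
under eq_bigr => k _.
  rewrite integral_sum//; last by move=> i; apply: integrable_sum.
  under eq_bigr => i _ do rewrite integral_sum//.
  over.
apply: (@le_trans _ _ (\sum_(k < d) \sum_(i < d)
   (a ord0 i ^+ 2 * (1 + 2 * (k == i)%:R))%:E)%E).
  apply: lee_sum => k _; apply: lee_sum => i _.
  rewrite (bigD1 i)//= big1 ?adde0; last first.
    move=> l li; rewrite /t; under eq_integral do rewrite EFinM.
    rewrite integralZl//.
    by rewrite fourth_offdiag ?mule0// eq_sym.
  rewrite /t; under eq_integral do rewrite EFinM.
  rewrite integralZl//.
  by rewrite -(expr2 (a ord0 i)) [leRHS]EFinM lee_wpmul2l ?lee_fin ?sqr_ge0.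
under eq_bigr do rewrite sumEFin.
rewrite sumEFin lee_fin exchange_big/= enorm_sqr /dotp mulr_sumr.
apply: ler_sum => i _.
rewrite -mulr_sumr big_split/= sumr_const card_ord -mulr_sumr.
rewrite (bigD1 i)//= big1 ?eqxx => [|k /negbTE -> //].
by rewrite addr0 mulr1 expr2 mulrC.
Qed.

Lemma gaussian_sixth_moment :
  (\int[P]_w (enorm (u w) ^+ 6)%:E <= (15 * d%:R ^+ 3)%:E)%E.
Proof.
(* The power mean inequality for the squares of the coordinates: their sum is cubed into a triple
   sum, and each product is bounded by [amgm3]. *)
have power_mean (x : 'rV[R]_d) : enorm x ^+ 6 <= d%:R ^+ 2 * \sum_(i < d) x ord0 i ^+ 6.
  rewrite (_ : 6 = 2 * 3)%N// exprM enorm_sqr /dotp.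
  pose y i := x ord0 i * x ord0 i.
  have y0 i : 0 <= y i by rewrite /y -expr2 sqr_ge0.
  rewrite (_ : \sum_(i < d) x ord0 i ^+ 6 = \sum_(i < d) y i ^+ 3); last first.
    by apply: eq_bigr => i _; rewrite /y; ring.
  rewrite -[X in X ^+ 3]/(\sum_(i < d) y i).
  have -> : (\sum_(i < d) y i) ^+ 3 =
      \sum_(i < d) \sum_(j < d) \sum_(k < d) y i * y j * y k.
    rewrite !exprS expr0 mulr1 mulr_suml; apply: eq_bigr => i _.
    rewrite mulr_suml mulr_sumr; apply: eq_bigr => j _.
    by rewrite !mulr_sumr; apply: eq_bigr => k _; rewrite mulrA.
  apply: (@le_trans _ _ (\sum_(i < d) \sum_(j < d) \sum_(k < d)
      (y i ^+ 3 + y j ^+ 3 + y k ^+ 3) / 3)).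
    do 3 (apply: ler_sum => ? _).
    apply: amgm3 => //.
  pose s := \sum_(i < d) y i ^+ 3.
  have sc (c0 : R) : \sum_(k < d) c0 = d%:R * c0.
    by rewrite sumr_const card_ord mulr_natl.
  have sk i j : \sum_(k < d) (y i ^+ 3 + y j ^+ 3 + y k ^+ 3) / 3 =
      (d%:R * (y i ^+ 3 + y j ^+ 3) + s) / 3.
    by rewrite -mulr_suml big_split/= sc.
  have sj i : \sum_(j < d) (d%:R * (y i ^+ 3 + y j ^+ 3) + s) / 3 =
      (d%:R * (d%:R * y i ^+ 3 + s) + d%:R * s) / 3.
    by rewrite -mulr_suml big_split/= sc -mulr_sumr big_split/= sc.
  under eq_bigr => i _ do (under eq_bigr => j _ do rewrite sk; rewrite sj).
  rewrite -mulr_suml big_split/= -mulr_sumr big_split/= -mulr_sumr.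
  rewrite !sc -/s.
  by rewrite le_eqVlt; apply/orP; left; apply/eqP; field.
apply: (@le_trans _ _ (\int[P]_w ((d%:R ^+ 2)%:E * \sum_(i < d) (c i w ^+ 6)%:E)%E)%E).
  apply: ge0_le_integral => //.
  - by move=> w _; rewrite lee_fin exprn_even_ge0.
  - apply/measurable_EFinP; apply: measurable_funX.
    exact: (measurableT_comp measurable_enorm).
  - apply: emeasurable_funM => //; apply: emeasurable_sum => i.
    by apply/measurable_EFinP; exact: measurable_funX.
  - by move=> w _; rewrite sumEFin -EFinM lee_fin.
rewrite ge0_integralZl//; first last.
- by move=> x _; apply: sume_ge0 => i _; rewrite lee_fin exprn_even_ge0.
- apply: emeasurable_sum => i.
  by apply/measurable_EFinP; exact: measurable_funX.
rewrite ge0_integral_sum//; first last.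
- by move=> i x _; rewrite lee_fin exprn_even_ge0.
- by move=> i; apply/measurable_EFinP; exact: measurable_funX.
apply: (@le_trans _ _ ((d%:R ^+ 2)%:E * \sum_(i < d) 15%:E)%E).
  by rewrite lee_wpmul2l ?lee_fin ?sqr_ge0//; apply: lee_sum => i _; exact: moment6.
rewrite sumEFin sumr_const card_ord -EFinM lee_fin -(mulr_natr _ d).
by rewrite le_eqVlt; apply/orP; left; apply/eqP; ring.
Qed.

End gaussian_vector.

(** * Measurability of gradients and iterates *)

Section difference_quotient.
Context {R : realType} {d : nat} {dZ : measure_display} {Z : measurableType dZ}.

(* [F ^~ z] may fail to be differentiable off [Omega], which is not known here to be
   measurable: the upper limit is measurable everywhere, and is the partial derivative
   wherever there is one. *)
Definition quotient_limsup (G : 'rV[R]_d * Z -> R) (i : 'I_d) (p : 'rV[R]_d * Z) : R :=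
  fine (limn_esup (fun n : nat => (n.+1%:R *
    (G (p.1 + n.+1%:R^-1 *: delta_mx ord0 i, p.2) - G p))%:E)).

Lemma measurable_quotient_limsup G i : measurable_fun setT G ->
  measurable_fun setT (quotient_limsup G i).
Proof.
move=> mG; apply: (measurableT_comp (f := fine)) => //.
apply: measurable_fun_limn_esup => n; apply/measurable_EFinP.
apply: measurable_funM => //; apply: measurable_funB => //.
apply: (measurableT_comp mG); apply: measurable_fun_pair => //=.
apply: measurable_fun_rV => j.
rewrite (_ : (fun w => _) = (fun p : 'rV[R]_d * Z =>
  p.1 ord0 j + (n.+1%:R^-1 *: delta_mx ord0 i : 'rV[R]_d) ord0 j)); last first.
  by apply/funext => p; rewrite mxE.
apply: measurable_funD => //.
exact: (measurableT_comp (measurable_coord j)).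
Qed.

Lemma quotient_limsupE G i x z : differentiable (fun y => G (y, z)) x ->
  quotient_limsup G i (x, z) = grad (fun y => G (y, z)) x ord0 i.
Proof.
move=> df; rewrite /grad mxE /quotient_limsup/=.
have dv := @diff_derivable _ _ _ _ _ (delta_mx ord0 i) df.
have c0 : (n.+1%:R^-1 : R) @[n --> \oo] --> 0^'.
  move=> A [e/= e0 HA].
  have /cvgrPdist_lt/(_ e e0) H := @cvg_harmonic R.
  change (\forall n \near \oo, A (n.+1%:R^-1)).
  by apply: filterS H => n Hn; apply: HA => /=; rewrite ?invr_neq0// pnatr_eq0.
have cq := cvg_comp _ _ c0 dv.
set l := lim _ in cq.
have cqE : (n.+1%:R * (G (x + n.+1%:R^-1 *: delta_mx ord0 i, z) - G (x, z)))%:E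
    @[n --> \oo] --> l%:E.
  apply: cvg_EFin; first exact: nearW.
  apply: cvg_trans cq; apply: near_eq_cvg; near=> n.
  by rewrite /= invrK (addrC x).
rewrite is_cvg_limn_esupE; last by apply/cvg_ex; exists l%:E.
by rewrite (cvg_lim _ cqE).
Unshelve. all: by end_near.
Qed.

End difference_quotient.

Lemma bigcap_seq_eqType {I : eqType} {T : Type} (s : seq I) (F : I -> set T) :
  \bigcap_(i in [set` s]) F i = \big[setI/setT]_(i <- s) F i.
Proof.
elim: s => [|i s IH].
  by rewrite big_nil; apply/seteqP; split => // x _ j.
rewrite big_cons -IH; apply/seteqP; split => x /= H.
  split; first by apply: H; rewrite /= inE eqxx.
  by move=> j js; apply: H; rewrite /= inE js orbT.
by move=> j; rewrite /= inE => /orP[/eqP ->|js]; [case: H|apply: H.2].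
Qed.

(** * The iterates as functions of the past *)

Section history.
Context {R : realType} {dW : measure_display} {W : measurableType dW}.
Variable P : probability W R.
Context {d : nat} (K : nat -> eqType) (S : forall t, K t -> set (set W)).
Variable v : nat -> {RV P >-> 'rV[R]_d}.

(** The induction runs over [s <= t] with the generators of time [t] fixed, so that the
    sigma-algebra on [W] does not change along the way. *)
Lemma sfw_iterate_history (gamma : nat -> R) x0 t A : measurable A ->
  history S v t (sfw_iterate gamma x0 v t @^-1` A).
Proof.
move=> mA; rewrite /history; set gens := [set A | _].
suff mx s : (s <= t)%N ->
    measurable_fun setT (sfw_iterate gamma x0 v s : g_sigma_algebraType gens -> _).
  have := mx t (leqnn t) measurableT A mA; rewrite setTI; exact.
elim: s => [_|s IH st]; first exact: measurable_cst.
have mv : measurable_fun setT (v s.+1 : g_sigma_algebraType gens -> _).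
  move=> _ B mB; apply: sub_sigma_algebra; exists s.+1; first by rewrite st.
  by left; exists B.
apply: measurable_fun_rV => i.
have mxi : measurable_fun setT (fun w : g_sigma_algebraType gens =>
    sfw_iterate gamma x0 v s w ord0 i).
  by apply: (measurableT_comp (measurable_coord i)); exact: IH (ltnW st).
rewrite (_ : (fun w => _) = (fun w => sfw_iterate gamma x0 v s w ord0 i + gamma s.+1 *
    (v s.+1 w ord0 i - sfw_iterate gamma x0 v s w ord0 i))); last first.
  by apply/funext => w /=; rewrite !mxE.
apply: measurable_funD => //; apply: measurable_funM => //.
apply: measurable_funB => //; exact: (measurableT_comp (measurable_coord i)).
Qed.

(** This does not follow from membership in [history]: the families [S] are arbitrary here, so
    events of the past need not be measurable. *)
Lemma measurable_sfw_iterate (gamma : nat -> R) x0 t :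
  measurable_fun setT (sfw_iterate gamma x0 v t).
Proof.
elim: t => [|s IH]; first exact: measurable_cst.
apply: measurable_fun_rV => i.
rewrite (_ : (fun w => _) = (fun w => sfw_iterate gamma x0 v s w ord0 i + gamma s.+1 *
    (v s.+1 w ord0 i - sfw_iterate gamma x0 v s w ord0 i))); last first.
  by apply/funext => w /=; rewrite !mxE.
have mxi := measurableT_comp (measurable_coord i) IH.
apply: measurable_funD => //; apply: measurable_funM => //.
by apply: measurable_funB => //; exact: (measurableT_comp (measurable_coord i)).
Qed.

Lemma fresh_prod T t (A : set W) (ks : seq (K t.+1)) (B : K t.+1 -> set W) :
  fresh S v T -> (t < T)%N -> history S v t A -> uniq ks ->
  (forall k, k \in ks -> S k (B k)) ->
  P (A `&` \big[setI/setT]_(k <- ks) B k) = (P A * \prod_(k <- ks) P (B k))%E.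
Proof.
move=> fr tT hA uks SB.
have := fr t tT (None :: map Some ks) (fun o => if o is Some k then B k else A).
rewrite bigcap_seq_eqType !big_cons !big_map; apply.
- rewrite /= map_inj_uniq ?uks ?andbT; last by move=> ? ? [].
  by apply/mapP => -[].
- move=> [k|//]; rewrite inE/= mem_map; first exact: SB.
  by move=> ? ? [].
Qed.

End history.

(** * Independence of pairs from products of events *)

Section independence_of_pairs.
Local Open Scope ereal_scope.
Context {R : realType} {dW d1 d2 d3 : measure_display} {W : measurableType dW}
  {T1 : measurableType d1} {T2 : measurableType d2} {T3 : measurableType d3}.
Variable P : probability W R.
Variables (X : W -> T1) (Y : W -> T2) (Z : W -> T3).
Hypotheses (mX : measurable_fun setT X) (mY : measurable_fun setT Y)
  (mZ : measurable_fun setT Z).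

Let preim dT (T : measurableType dT) (f : W -> T) A : measurable_fun setT f ->
  measurable A -> measurable (f @^-1` A).
Proof. by move=> mf mA; rewrite -[X in measurable X]setTI; exact: mf. Qed.

Lemma indep_pairl :
  (forall A B C, measurable A -> measurable B -> measurable C ->
    P (X @^-1` A `&` Y @^-1` B `&` Z @^-1` C) =
    P (X @^-1` A `&` Y @^-1` B) * P (Z @^-1` C)) ->
  indep P (fun w => (X w, Y w)) Z.
Proof.
move=> H A C mA mC.
have mZC := preim mZ mC.
have c0 : (0 <= fine (P (Z @^-1` C)))%R by rewrite fine_ge0.
rewrite (pair_event_unique c0 mX mY mZC measurableT _ mA).
  by rewrite setIT muleC fineK// fin_num_measure.
by move=> A1 B1 mA1 mB1; rewrite setIT H// muleC fineK// fin_num_measure.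
Qed.

Lemma indep_pairr :
  (forall A B C, measurable A -> measurable B -> measurable C ->
    P (X @^-1` A `&` (Y @^-1` B `&` Z @^-1` C)) =
    P (X @^-1` A) * P (Y @^-1` B `&` Z @^-1` C)) ->
  indep P X (fun w => (Y w, Z w)).
Proof.
move=> H A C mA mC.
have mXA := preim mX mA.
have c0 : (0 <= fine (P (X @^-1` A)))%R by rewrite fine_ge0.
rewrite setIC (pair_event_unique c0 mY mZ mXA measurableT _ mC).
  by rewrite setIT fineK// fin_num_measure.
by move=> A1 B1 mA1 mB1; rewrite setIT setIC H// fineK// fin_num_measure.
Qed.

End independence_of_pairs.

Section independence_of_pairs_pairs.
Local Open Scope ereal_scope.
Context {R : realType} {dW d1 d2 d3 d4 d5 : measure_display} {W : measurableType dW}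
  {T1 : measurableType d1} {T2 : measurableType d2} {T3 : measurableType d3}
  {T4 : measurableType d4} {T5 : measurableType d5}.
Variable P : probability W R.

(** Rectangles are extended to general events one pair at a time: first for [(Y', Z')], then for [X]
    with [(Y, Z)], and finally for [(Y, Z)] itself while the event of [X] is held fixed. *)
Lemma indep_pair_pairs (X : W -> T1) (Y : W -> T2) (Z : W -> T3) (Y' : W -> T4)
    (Z' : W -> T5) :
  measurable_fun setT X -> measurable_fun setT Y -> measurable_fun setT Z ->
  measurable_fun setT Y' -> measurable_fun setT Z' ->
  (forall A B C B' C', measurable A -> measurable B -> measurable C ->
    measurable B' -> measurable C' ->
    P (X @^-1` A `&` (Y @^-1` B `&` Z @^-1` C) `&` (Y' @^-1` B' `&` Z' @^-1` C')) =
    P (X @^-1` A `&` (Y @^-1` B `&` Z @^-1` C)) * P (Y' @^-1` B' `&` Z' @^-1` C')) ->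
  indep P (fun w => (X w, (Y w, Z w))) (fun w => (Y' w, Z' w)).
Proof.
move=> mX mY mZ mY' mZ' H.
have mYZ : measurable_fun setT (fun w => (Y w, Z w)) by exact: measurable_fun_pair.
have preim dT (T : measurableType dT) (f : W -> T) A : measurable_fun setT f ->
    measurable A -> measurable (f @^-1` A).
  by move=> mf mA; rewrite -[X in measurable X]setTI; exact: mf.
apply: indep_pairr => //; first exact: measurable_fun_pair.
move=> D B' C' mD mB' mC'; set E := _ @^-1` B' `&` _.
have mE : measurable E by apply: measurableI; exact: preim.
have c0 : (0 <= fine (P E))%R by rewrite fine_ge0.
rewrite (pair_event_unique c0 mX mYZ mE measurableT _ mD).
  by rewrite setIT muleC fineK// fin_num_measure.
move=> A F mA mF; rewrite setIT [X in X `&` E]setIC -setIA [in RHS]setIC.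
have mXA := preim _ _ _ _ mX mA.
(* The event of [X] is carried by both sides: it is the [E'] of this instance. *)
apply: (pair_event_unique c0 mY mZ _ mXA _ mF) => [|B C mB mC].
  exact: measurableI.
by rewrite setIA [X in X `&` E]setIC [in RHS]setIC H// muleC fineK// fin_num_measure.
Qed.
End independence_of_pairs_pairs.

(** * Expectations of parametrized and dominated quantities *)

Section integrals.
Local Open Scope ereal_scope.

(** The objective is only given as a mean of sample functions; its measurability comes from Tonelli
    applied to their positive and negative parts. *)
Lemma measurable_mean {R : realType} {d1 d2 : measure_display} {T1 : measurableType d1}
    {T2 : measurableType d2} (m : {sigma_finite_measure set T2 -> \bar R})
    (F : T1 -> T2 -> R) (f : T1 -> R) :
  measurable_fun setT (fun p : T1 * T2 => F p.1 p.2) ->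
  (forall x, \int[m]_y (F x y)%:E = (f x)%:E) -> measurable_fun setT f.
Proof.
move=> mF fE.
have mE : measurable_fun setT (fun p : T1 * T2 => (F p.1 p.2)%:E).
  exact/measurable_EFinP.
apply/measurable_EFinP.
rewrite (_ : EFin \o f = fun x => \int[m]_y (fun p => (F p.1 p.2)%:E)^\+ (x, y)
   - \int[m]_y (fun p => (F p.1 p.2)%:E)^\- (x, y)); last first.
  apply/funext => x /=; rewrite -fE integralE; congr (_ - _).
    by apply: eq_integral => y _; rewrite !funeposE.
  by apply: eq_integral => y _; rewrite !funenegE.
apply: emeasurable_funB.
  by apply: measurable_fun_fubini_tonelli_F => //; exact: measurable_funepos.
by apply: measurable_fun_fubini_tonelli_F => //; exact: measurable_funeneg.
Qed.

(** A common frame for both settings: [e] and [e'] are successive gaps, [q] is the squared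
    estimation error, [n] the average of the sixth powers of the directions. Everything is
    nonnegative, so no integrability has to be known beforehand. The inequality is almost sure
    because the sample functions are smooth only almost surely. *)
Lemma ae_expected_le {R : realType} {dW : measure_display} {W : measurableType dW}
    (P : probability W R) (e' e q n : W -> R) (a b c k r s s' : R) :
  measurable_fun setT e' -> measurable_fun setT e -> measurable_fun setT q ->
  measurable_fun setT n ->
  (forall w, 0 <= e' w)%R -> (forall w, 0 <= e w)%R -> (forall w, 0 <= q w)%R ->
  (forall w, 0 <= n w)%R -> (0 <= a)%R -> (0 <= b)%R -> (0 <= c)%R -> (0 <= k)%R ->
  {ae P, forall w, e' w <= a * e w + b * q w + c * n w + k}%R ->
  \int[P]_w (e w)%:E <= r%:E -> \int[P]_w (q w)%:E <= s%:E ->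
  \int[P]_w (n w)%:E <= s'%:E ->
  \int[P]_w (e' w)%:E <= (a * r + b * s + c * s' + k)%:E.
Proof.
move=> me' me mq mn e'0 e0 q0 n0 a0 b0 c0 k0 le ir is1 is2.
have mM (x : R) (g : W -> R) : measurable_fun setT g ->
    measurable_fun setT (fun w => x%:E * (g w)%:E).
  by move=> mg; apply: emeasurable_funM => //; exact/measurable_EFinP.
apply: (@le_trans _ _ (\int[P]_w
    (a%:E * (e w)%:E + b%:E * (q w)%:E + c%:E * (n w)%:E + k%:E))).
  apply: ae_ge0_le_integral => //.
  - by move=> w _; rewrite lee_fin.
  - exact/measurable_EFinP.
  - by move=> w _; rewrite -!EFinM -!EFinD lee_fin !addr_ge0// mulr_ge0.
  - apply: emeasurable_funD => //.
    by do 2 (apply: emeasurable_funD; last exact: mM); exact: mM.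
  - by apply: filterS le => w H _; rewrite -!EFinM -!EFinD lee_fin.
rewrite ge0_integralD//; last 2 first.
- by move=> w _; rewrite -!EFinM -!EFinD lee_fin !addr_ge0// mulr_ge0.
- by do 2 (apply: emeasurable_funD; last exact: mM); exact: mM.
rewrite ge0_integralD//; last 4 first.
- by move=> w _; rewrite -!EFinM -!EFinD lee_fin !addr_ge0// mulr_ge0.
- by apply: emeasurable_funD; exact: mM.
- by move=> w _; rewrite -!EFinM lee_fin mulr_ge0.
- exact: mM.
rewrite ge0_integralD//; last 4 first.
- by move=> w _; rewrite -!EFinM lee_fin mulr_ge0.
- exact: mM.
- by move=> w _; rewrite -!EFinM lee_fin mulr_ge0.
- exact: mM.
have iM (x : R) (g : W -> R) (y : R) : measurable_fun setT g -> (0 <= x)%R ->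
    (forall w, 0 <= g w)%R -> \int[P]_w (g w)%:E <= y%:E ->
    \int[P]_w (x%:E * (g w)%:E) <= (x * y)%:E.
  move=> mg x0 g0 gy; rewrite ge0_integralZl_EFin//; last exact/measurable_EFinP.
    by rewrite EFinM lee_wpmul2l.
  by move=> w _; rewrite lee_fin.
rewrite integral_cst//= probability_setT mule1 !EFinD.
by rewrite !leeD// iM.
Qed.

(** In the zeroth-order setting raw second moments are bounded, whereas averaging needs centred
    errors. An infinite second moment makes the claim trivial. *)
Lemma integral_sqr_sub_mean_le {R : realType} {dW : measure_display}
    {W : measurableType dW} (P : probability W R) (Y : W -> R) (m : R) :
  measurable_fun setT Y -> \int[P]_w (Y w)%:E = m%:E ->
  \int[P]_w ((Y w - m) ^+ 2)%:E <= \int[P]_w (Y w ^+ 2)%:E.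
Proof.
move=> mY Ym.
have [Y2|] := ltP (\int[P]_w (Y w ^+ 2)%:E) +oo; last first.
  by rewrite leye_eq => /eqP ->; exact: leey.
have iY := integrable_sqr mY Y2.
have iY2 := integrable_sqrM mY mY Y2 Y2.
rewrite (_ : \int[P]_w (Y w ^+ 2)%:E = \int[P]_w (Y w * Y w)%:E); last first.
  by apply: eq_integral => w _; rewrite expr2.
rewrite (_ : \int[P]_w ((Y w - m) ^+ 2)%:E = \int[P]_w
    ((Y w * Y w)%:E - ((2 * m)%:E * (Y w)%:E - (m ^+ 2)%:E))); last first.
  by apply: eq_integral => w _; rewrite -EFinM -!EFinB; congr EFin; ring.
have ic (x : R) : P.-integrable setT (fun=> x%:E) by exact: finite_measure_integrable_cst.
have iZ : P.-integrable setT (fun w => (2 * m)%:E * (Y w)%:E) by exact: integrableZl.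
rewrite integralB//; last exact: integrableB.
rewrite integralB// integralZl// Ym integral_cst//= probability_setT mule1.
rewrite -EFinM -EFinB leeBlDr// -[leLHS]adde0 leeD2l// lee_fin.
have := sqr_ge0 m; lra.
Qed.

End integrals.

(** * One iteration *)

Lemma step_size_itv {R : realType} (t : nat) : 0 <= (step_size t.+1 : R) <= 1.
Proof.
rewrite /step_size -natr1 divr_ge0 ?addr_ge0//= ler_pdivrMr ?mul1r.
  by have := ler0n R t; lra.
by have := ler0n R t; lra.
Qed.

Lemma young {R : realFieldType} (c x y : R) : 0 < c ->
  x * y <= c * x ^+ 2 / 2 + y ^+ 2 / (2 * c).
Proof.
move=> c0; rewrite -subr_ge0.
rewrite [X in 0 <= X](_ : _ = (c * x - y) ^+ 2 / (2 * c)); last first.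
  by field; rewrite gt_eqF.
by rewrite divr_ge0 ?sqr_ge0// mulr_ge0// ltW.
Qed.

Lemma row_subE {R : zmodType} {d : nat} (a b : 'rV[R]_d) k :
  (a - b) ord0 k = a ord0 k - b ord0 k.
Proof. by rewrite mxE [X in _ + X]mxE. Qed.

Lemma integral_prodM {R : realType} {d1 d2 : measure_display}
    {T1 : measurableType d1} {T2 : measurableType d2}
    (m1 : probability T1 R) (m2 : probability T2 R) (a : T1 -> R) (b : T2 -> R) :
  m1.-integrable setT (fun x => (a x)%:E) -> m2.-integrable setT (fun y => (b y)%:E) ->
  (m1 \x m2)%E.-integrable setT (fun p => (a p.1 * b p.2)%:E) /\
  (\int[m1 \x m2]_p (a p.1 * b p.2)%:E =
    \int[m1]_x (a x)%:E * \int[m2]_y (b y)%:E)%E.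
Proof.
move=> ia ib.
have /integrableP[/measurable_EFinP ma aoo] := ia.
have /integrableP[/measurable_EFinP mb boo] := ib.
have mab : measurable_fun setT (fun p : T1 * T2 => (a p.1 * b p.2)%:E).
  apply/measurable_EFinP; apply: measurable_funM.
    exact: (measurableT_comp ma).
  exact: (measurableT_comp mb).
have iab : (m1 \x m2)%E.-integrable setT (fun p => (a p.1 * b p.2)%:E).
  apply/(integrable12ltyP m1 m2 mab).
  rewrite (_ : \int[m1]_x _ = \int[m1]_x (`|(a x)%:E| * \int[m2]_y `|(b y)%:E|))%E.
    rewrite ge0_integralZr//; last 2 first.
    - by apply: measurableT_comp => //; exact/measurable_EFinP.
    - exact: integral_ge0.
    rewrite lte_mul_pinfty//; first exact: integral_ge0.
    by rewrite ge0_fin_numE//; exact: integral_ge0.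
  apply: eq_integral => x _; rewrite -ge0_integralZl//.
  - by apply: eq_integral => y _; rewrite EFinM abseM.
  - by apply: measurableT_comp => //; exact/measurable_EFinP.
split => //.
rewrite -integral12_prod_meas1// /fubini_F/=.
transitivity (\int[m1]_x ((a x)%:E * \int[m2]_y (b y)%:E))%E.
  apply: eq_integral => x _; under eq_integral do rewrite EFinM.
  by rewrite integralZl.
have /fineK <- : (\int[m2]_y (b y)%:E)%E \is a fin_num by exact: integrable_fin_num.
by rewrite integralZr.
Qed.

(** A pathwise bound: [M] is the error of the unbiased part, and what remains is the
    finite-difference error [D' j - dotp (a j) (u j)] along [u j]. The weight [s] is left free, to
    be balanced against the sixth moment. *)
Lemma zo_error_le {R : realType} {d b : nat} (L nu D s : R) (G y : 'rV[R]_d)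
    (a u : 'I_b -> 'rV[R]_d) (D' : 'I_b -> R) :
  (0 < b)%N -> 0 <= L -> 0 <= nu -> 0 < s -> enorm y <= D ->
  (forall j, `|D' j - dotp (a j) (u j)| <= L / 2 * nu * enorm (u j) ^+ 2) ->
  dotp (G - b%:R^-1 *: \sum_(j < b) D' j *: u j) y
    <= D * enorm (b%:R^-1 *: \sum_(j < b) dotp (a j) (u j) *: u j - G)
       + L * nu * D / (4 * s) * (b%:R^-1 * \sum_(j < b) enorm (u j) ^+ 6)
       + L * nu * D * s / 4.
Proof.
move=> b0 L0 nu0 s0 yD aD.
have D0 : 0 <= D by exact: le_trans (enorm_ge0 y) yD.
have bR : 0 < b%:R :> R by rewrite ltr0n.
set M := b%:R^-1 *: \sum_(j < b) dotp (a j) (u j) *: u j - G.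
have -> : dotp (G - b%:R^-1 *: \sum_(j < b) D' j *: u j) y = - dotp M y
    + b%:R^-1 * \sum_(j < b) (- (D' j - dotp (a j) (u j)) * dotp (u j) y).
  rewrite /M !dotpBl !dotpZl !dotp_suml opprB -addrA; congr (_ + _).
  rewrite (_ : \sum_(j < b) - (D' j - dotp (a j) (u j)) * dotp (u j) y =
      \sum_(j < b) dotp (dotp (a j) (u j) *: u j) y - \sum_(j < b) dotp (D' j *: u j) y).
    by ring.
  by rewrite -sumrB; apply: eq_bigr => j _; rewrite !dotpZl; ring.
have h1 : - dotp M y <= D * enorm M.
  rewrite -dotpNl (le_trans (dotp_le_enorm _ _))// -scaleN1r enormZ normrN1 mul1r.
  by rewrite mulrC ler_wpM2r ?enorm_ge0.
have h2 j : - (D' j - dotp (a j) (u j)) * dotp (u j) y <=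
    L * nu * D / (4 * s) * enorm (u j) ^+ 6 + L * nu * D * s / 4.
  apply: (@le_trans _ _ ((L / 2 * nu * enorm (u j) ^+ 2) * (enorm (u j) * D))).
    apply: le_trans (ler_norm _) _; rewrite normrM normrN ler_pM//.
    rewrite (le_trans (normr_dotp_le_enorm _ _))// ler_wpM2l ?enorm_ge0//.
  (* The odd power [|u| ^ 3] is traded for the even power [|u| ^ 6] plus a constant, as only even
     moments are at hand. *)
  have := young 1 (enorm (u j) ^+ 3) s0; rewrite mul1r expr1n mulr1 -exprM.
  have c0 : 0 <= L * nu * D / 2 by rewrite !mulr_ge0.
  move=> /(ler_wpM2l c0); rewrite -[(3 * 2)%N]/6%N.
  have -> : L / 2 * nu * enorm (u j) ^+ 2 * (enorm (u j) * D) =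
    L * nu * D / 2 * enorm (u j) ^+ 3 by ring.
  move=> /le_trans; apply.
  by rewrite le_eqVlt; apply/orP; left; apply/eqP; field; rewrite gt_eqF.
rewrite -addrA lerD//.
have bV : 0 <= b%:R^-1 :> R by rewrite invr_ge0.
apply: (@le_trans _ _ (b%:R^-1 * \sum_(j < b)
    (L * nu * D / (4 * s) * enorm (u j) ^+ 6 + L * nu * D * s / 4))).
  by rewrite ler_wpM2l//; apply: ler_sum => j _; exact: h2.
rewrite big_split/= -mulr_sumr sumr_const card_ord -(mulr_natl (L * nu * D * s / 4)).
by rewrite mulrDr mulrCA lerD2l mulKf ?gt_eqF.
Qed.

Lemma integrable_distribution {R : realType} {d1 d2 : measure_display}
    {T1 : measurableType d1} {T2 : measurableType d2} (P : probability T1 R)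
    (X : {RV P >-> T2}) (g : T2 -> \bar R) :
  measurable_fun setT g -> P.-integrable setT (fun w => g (X w)) ->
  (distribution P X).-integrable setT g.
Proof.
move=> mg /integrableP[_ goo]; apply/integrableP; split => //.
by rewrite ge0_integral_distribution//; exact: measurableT_comp.
Qed.

(** * Expected decrease in one step, in both settings *)

Section steps.
Context {R : realType} {d : nat} {dX : measure_display} {Xi : measurableType dX}
  {dW : measure_display} {W : measurableType dW}.
Variables (P : probability W R) (Pxi : probability Xi R).
Variables (L D rho : R) (Omega : set 'rV[R]_d) (F : 'rV[R]_d -> Xi -> R)
  (f : 'rV[R]_d -> R) (x0 xstar : 'rV[R]_d).
Hypotheses (hL : 0 < L) (hD : 0 < D) (hrho : 0 < rho).
Hypothesis pb : sfw_problem L D Pxi Omega F f x0 xstar.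
Variable v : nat -> {RV P >-> 'rV[R]_d}.

Local Notation x t w := (sfw_iterate step_size x0 v t w).
Local Notation gap y := (f y - f xstar).

Lemma sfw_iterate_in (T t : nat) (w : W) :
  (forall s, (s < T)%N -> Omega (v s.+1 w)) -> (t <= T)%N -> Omega (x t w).
Proof.
move=> Ov; elim: t => [_|t IH tT]; first exact: pb_start pb.
apply: convex_set_segment; [exact: pb_convex pb|exact/IH/ltnW|exact: Ov|].
exact: step_size_itv.
Qed.

Lemma gap_ge0 y : Omega y -> 0 <= gap y.
Proof. by move=> Oy; rewrite subr_ge0; exact: (pb_minimum pb).2. Qed.

Lemma measurable_objective : measurable_fun setT f.
Proof.
apply: (measurable_mean (m := Pxi) (pb_F_measurable pb)) => y.
by have := pb_mean pb y; rewrite unlock.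
Qed.

Let mx t : measurable_fun setT (fun w => x t w) := measurable_sfw_iterate v step_size x0 t.

Let mgap t : measurable_fun setT (fun w => gap (x t w)).
Proof. by apply: measurable_funB => //; exact: (measurableT_comp measurable_objective). Qed.

Let dF_grad k (y : 'rV[R]_d) (z : Xi) :
  Omega y -> quotient_limsup (fun p => F p.1 p.2) k (y, z) = grad (F ^~ z) y ord0 k.
Proof. by move=> Oy; apply: quotient_limsupE; exact: pb_F_differentiable pb z y Oy. Qed.

Let df_grad k (y : 'rV[R]_d) (z : Xi) :
  Omega y -> quotient_limsup (fun p => f p.1) k (y, z) = grad f y ord0 k.
Proof.
move=> Oy; apply: (quotient_limsupE (G := fun p => f p.1)).
exact: pb_f_differentiable pb y Oy.
Qed.

Let mF := pb_F_measurable pb.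

Let mf' {dZ} {Z : measurableType dZ} : measurable_fun setT (fun p : 'rV[R]_d * Z => f p.1).
Proof. exact: (measurableT_comp measurable_objective). Qed.

(** Young's inequality with weight [rho * L * g] costs [g ^+ 2 * rho * L * D ^+ 2 / 2] and leaves
    the squared error divided by [2 * rho * L]. In expectation the growth condition cancels that
    factor, leaving at most [r / b]. *)
Lemma first_order_step (T t : nat) (xi : nat -> nat -> {RV P >-> Xi}) (r : R) :
  first_order_assumption L rho Pxi Omega F f xstar ->
  first_order_run Pxi Omega F x0 step_size fo_batch T xi v ->
  (t < T)%N -> 0 <= r ->
  (\int[P]_w (gap (x t w))%:E <= r%:E)%E ->
  (\int[P]_w (gap (x t.+1 w))%:E <=
    ((1 - step_size t.+1 / 2) * r
      + step_size t.+1 ^+ 2 * ((rho + 1) * L * D ^+ 2) / 2)%:E)%E.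
Proof.
move=> foa run tT r0 ir.
have Ov s w : (s < T)%N -> Omega (v s.+1 w) by move=> sT; exact: (fo_lmo run w sT).1.
have Ox s w : (s <= T)%N -> Omega (x s w).
  by move=> sT; apply: (@sfw_iterate_in T) => // ? ?; exact: Ov.
set g := step_size t.+1.
have /andP[g0 g1] : 0 <= g <= 1 by exact: step_size_itv.
have g_gt0 : 0 < g by rewrite /g /step_size divr_gt0// addr_gt0.
pose b := fo_batch t.+1.
have b0 : (0 < b)%N by rewrite /b /fo_batch addn3.
(* Gradient noise, written with upper limits of difference quotients to be measurable on the whole
   space; at the iterates it is the true noise. *)
pose h (k : 'I_d) (p : 'rV[R]_d * Xi) : R :=
  quotient_limsup (fun p => F p.1 p.2) k p - quotient_limsup (fun p => f p.1) k p.
have mh k : measurable_fun setT (h k).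
  by apply: measurable_funB; apply: measurable_quotient_limsup.
pose X : {mfun W >-> 'rV[R]_d} := mfun_of (mx t).
pose Z (j : 'I_b) : {mfun W >-> Xi} := xi t.+1 j.
have law j (G : Xi -> \bar R) :
    (\int[distribution P (Z j)]_z G z = \int[Pxi]_z G z)%E.
  apply: eq_measure_integral => A mA _.
  exact: (fo_law run (t := t.+1) tT (ltn_ord j) mA).
have prod (A : set 'rV[R]_d) (ks : seq 'I_b) (B : 'I_b -> set Xi) : measurable A -> uniq ks ->
    (forall k, k \in ks -> measurable (B k)) ->
    P (X @^-1` A `&` \big[setI/setT]_(k <- ks) (Z k @^-1` B k)) =
    (P (X @^-1` A) * \prod_(k <- ks) P (Z k @^-1` B k))%E.
  move=> mA uks mB.
  apply: (fresh_prod (fo_fresh run)) => //.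
    exact: sfw_iterate_history.
  move=> k kks. exists (B k); [exact: mB|by rewrite setTI].
have hE w k z : h k (X w, z) = grad (F ^~ z) (x t w) ord0 k - grad f (x t w) ord0 k.
  by rewrite /h dF_grad ?df_grad//; apply: Ox; exact: ltnW.
have mh2 : (\int[P]_w (\sum_(k < d) (b%:R^-1 * \sum_(j < b) h k (X w, Z j w)) ^+ 2)%:E
    <= (b%:R^-1)%:E * \int[P]_w (2 * rho * L * gap (x t w))%:E)%E.
  apply: (minibatch_variance (X := X) (Z := Z)) => //.
  - move=> j A B mA mB.
    have := prod A [:: j] (fun=> B) mA isT (fun _ _ => mB).
    by rewrite !big_seq1.
  - move=> i j ij; apply: indep_pairl => // A B C mA mB mC.
    have uij : uniq [:: i; j] by rewrite /= inE ij.
    pose BC k := if k == i then B else C.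
    have mBC k : k \in [:: i; j] -> measurable (BC k) by rewrite /BC; case: ifP.
    have := prod A _ _ mA uij mBC.
    rewrite !big_cons !big_nil setIT mule1 /BC eqxx eq_sym (negbTE ij) setIA => ->.
    have := prod A [:: i] (fun=> B) mA isT (fun _ _ => mB).
    by rewrite !big_seq1 muleA => <-.
  - move=> k j w; rewrite law.
    under eq_integral do rewrite hE EFinB.
    have Oxw := Ox _ w (ltnW tT).
    rewrite integralB//; last 2 first.
    + exact: (pb_grad_integrable pb k Oxw).
    + exact: finite_measure_integrable_cst.
    have := pb_unbiased pb k Oxw; rewrite unlock => ->.
    by rewrite integral_cst//= probability_setT mule1 subee.
  - move=> j w; have Oxw := Ox _ w (ltnW tT).
    under eq_bigr do rewrite law.
    rewrite -ge0_integral_sum//; last 2 first.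
    + move=> k; apply/measurable_EFinP; apply: measurable_funX.
      exact: (measurableT_comp (mh k)).
    + by move=> k z _; rewrite lee_fin sqr_ge0.
    have := foa _ Oxw; rewrite unlock; apply: le_trans.
    rewrite le_eqVlt; apply/orP; left; apply/eqP; apply: eq_integral => z _.
    rewrite sumEFin enorm_sqr; congr EFin; apply: eq_bigr => k _.
    by rewrite hE row_subE expr2.
  - by apply: measurable_funM.
  - under eq_integral do rewrite EFinM.
    rewrite ge0_integralZl_EFin//; last 3 first.
    + by move=> w _; rewrite lee_fin; apply/gap_ge0/Ox/ltnW.
    + exact/measurable_EFinP.
    + by rewrite !mulr_ge0// ltW.
    by rewrite lte_mul_pinfty ?lee_fin ?mulr_ge0 ?ltW// (le_lt_trans ir) ?ltry.
pose q w := \sum_(k < d) (b%:R^-1 * \sum_(j < b) h k (X w, Z j w)) ^+ 2.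
have q0 w : 0 <= q w by apply: sumr_ge0 => k _; exact: sqr_ge0.
have mq : measurable_fun setT q.
  apply: measurable_sum => k; apply: measurable_funX; apply: measurable_funM => //.
  apply: measurable_sum => j; apply: (measurableT_comp (mh k)).
  exact: measurable_fun_pair.
have qE w : q w = enorm (grad f (x t w) - fo_estimate F b (x t w) (fun i => xi t.+1 i w)) ^+ 2.
  rewrite enorm_sqr; apply: eq_bigr => k _; rewrite row_subE -expr2 -[RHS]sqrrN opprB.
  congr (_ ^+ 2); rewrite /fo_estimate mxE summxE.
  under eq_bigr do rewrite hE.
  rewrite sumrB sumr_const card_ord mulrBr -(mulr_natl (grad f _ _ _)) mulrA.
  by rewrite mulVf ?mul1r// pnatr_eq0 -lt0n.
(* The summand [0 * 0] is the slot of the finite-difference remainder in [ae_expected_le]. *)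
have pw w : gap (x t.+1 w) <= (1 - g) * gap (x t w) + (2 * rho * L)^-1 * q w
    + 0 * 0 + g ^+ 2 * ((rho + 1) * L * D ^+ 2) / 2.
  have [Oxw Oxw'] := (Ox _ w (ltnW tT), (pb_minimum pb).1).
  have lmo := fo_lmo run w tT.
  have g01 : 0 <= g <= 1 by rewrite g0.
  have := frank_wolfe_step (ltW hL) g01 (pb_convex pb) (pb_diameter pb)
    (pb_f_convex pb) (pb_f_differentiable pb) (pb_f_smooth pb) Oxw' Oxw lmo.
  move/le_trans; apply; rewrite -/b qE.
  set e := grad f _ - _.
  have de : dotp e (v t.+1 w - xstar) <= D * enorm e.
    rewrite (le_trans (dotp_le_enorm _ _))// mulrC ler_wpM2r ?enorm_ge0//.
    by apply: (pb_diameter pb) => //; exact: Ov.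
  have c0 : 0 < rho * L * g by rewrite !mulr_gt0.
  have := le_trans de (young D (enorm e) c0) => /(ler_wpM2l g0).
  have -> : g * (rho * L * g * D ^+ 2 / 2 + enorm e ^+ 2 / (2 * (rho * L * g))) =
      g ^+ 2 * rho * L * D ^+ 2 / 2 + (2 * rho * L)^-1 * enorm e ^+ 2.
    by field; rewrite ?gt_eqF.
  lra.
have s1 : (\int[P]_w (q w)%:E <= (b%:R^-1 * (2 * rho * L * r))%:E)%E.
  apply: le_trans mh2 _; rewrite EFinM lee_wpmul2l ?lee_fin ?invr_ge0//.
  under eq_integral do rewrite EFinM.
  rewrite ge0_integralZl_EFin//; last 3 first.
  - by move=> w _; rewrite lee_fin; apply/gap_ge0/Ox/ltnW.
  - exact/measurable_EFinP.
  - by rewrite !mulr_ge0// ltW.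
  rewrite [leRHS]EFinM; apply: lee_wpmul2l => //.
  by rewrite lee_fin !mulr_ge0// ltW.
have kge0 : 0 <= g ^+ 2 * ((rho + 1) * L * D ^+ 2) / 2.
  by rewrite !(mulr_ge0, sqr_ge0, addr_ge0)// ltW.
have cge0 : 0 <= (2 * rho * L)^-1 by rewrite invr_ge0 !mulr_ge0// ltW.
have int0 : (\int[P]_w ((fun=> 0 : R) w)%:E <= 0%:E)%E by rewrite integral0.
have := @ae_expected_le _ _ _ P (fun w => gap (x t.+1 w)) (fun w => gap (x t w)) q
  (fun=> 0) (1 - g) (2 * rho * L)^-1 0 (g ^+ 2 * ((rho + 1) * L * D ^+ 2) / 2)
  r _ 0 (mgap _) (mgap _) mq (measurable_cst _) (fun w => gap_ge0 (Ox _ w tT))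
  (fun w => gap_ge0 (Ox _ w (ltnW tT))) q0 (fun=> lexx _) _ cge0 (lexx _) kge0
  (aeW _ pw) ir s1 int0.
rewrite subr_ge0 => /(_ g1)/le_trans; apply.
rewrite lee_fin mul0r addr0 lerD2r.
(* The batch size is chosen for this: [2 / g] is [(t.+1 + 3) / 2], and [b] is its ceiling. *)
have b1 : b%:R^-1 <= g / 2.
  rewrite /g /step_size /b /fo_batch.
  have -> : t.+1%:R + 3 = (t.+1 + 3)%N%:R :> R by rewrite natrD.
  set n := (t.+1 + 3)%N.
  have n0 : 0 < n%:R :> R by rewrite /n addn3 ltr0n.
  have -> : 4 / n%:R / 2 = (n%:R / 2)^-1 :> R by field; rewrite gt_eqF.
  rewrite lef_pV2 ?posrE ?divr_gt0 ?ltr0n//.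
    rewrite ler_pdivrMr// -natrM ler_nat muln2 -[leqLHS]odd_double_half.
    by rewrite uphalf_half doubleD leq_add2r; case: (odd n).
rewrite (_ : (2 * rho * L)^-1 * _ = b%:R^-1 * r); last first.
  by field; rewrite !gt_eqF// ltr0n.
have := ler_wpM2r r0 b1; lra.
Qed.

(** The budget for the coefficient of [g ^+ 2 * L * D ^+ 2] is [rho / 4] from Young's inequality,
    [1 / 2] from the finite differences and [1 / 2] from smoothness of [f]. *)
Lemma zeroth_order_step (T t : nat) (xi : nat -> nat -> {RV P >-> Xi})
    (u : nat -> nat -> {RV P >-> 'rV[R]_d}) (r : R) :
  zeroth_order_assumption L rho Pxi Omega F f xstar ->
  zeroth_order_run Pxi Omega F x0 step_size (zo_batch d) (zo_radius D d T) T xi u v ->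
  (t < T)%N -> 0 <= r ->
  (\int[P]_w (gap (x t w))%:E <= r%:E)%E ->
  (\int[P]_w (gap (x t.+1 w))%:E <=
    ((1 - step_size t.+1 / 2) * r
      + step_size t.+1 ^+ 2 * ((rho + rho^-1 + 1) * L * D ^+ 2) / 2)%:E)%E.
Proof.
move=> zoa run tT r0 ir.
have Ov s w : (s < T)%N -> Omega (v s.+1 w) by move=> sT; exact: (zo_lmo run w sT).1.
have Ox s w : (s <= T)%N -> Omega (x s w).
  by move=> sT; apply: (@sfw_iterate_in T) => // ? ?; exact: Ov.
set g := step_size t.+1.
have /andP[g0 g1] : 0 <= g <= 1 by exact: step_size_itv.
have g_gt0 : 0 < g by rewrite /g /step_size divr_gt0// addr_gt0.
pose b := zo_batch d t.+1.
have b0 : (0 < b)%N by rewrite /b /zo_batch addn3 addn4.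
pose qF i (p : 'rV[R]_d * Xi) := quotient_limsup (fun p => F p.1 p.2) i p.
have mqF i : measurable_fun setT (qF i) by exact: measurable_quotient_limsup.
(* Coordinate [k] of [<grad F, u> u]. A sample is now the pair of [xi] and its direction, so that
   the mini-batch bound applies unchanged. *)
pose Y (k : 'I_d) (p : 'rV[R]_d * (Xi * 'rV[R]_d)) : R :=
  dotp (\row_i qF i (p.1, p.2.1)) p.2.2 * p.2.2 ord0 k.
pose h (k : 'I_d) (p : 'rV[R]_d * (Xi * 'rV[R]_d)) : R :=
  Y k p - quotient_limsup (fun p => f p.1) k (p.1, p.2.1).
have m12 : measurable_fun setT
    (fun p : 'rV[R]_d * (Xi * 'rV[R]_d) => (p.1, p.2.1)).
  by apply: measurable_fun_pair => //; exact: measurableT_comp.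
have m22 : measurable_fun setT (fun p : 'rV[R]_d * (Xi * 'rV[R]_d) => p.2.2).
  exact: measurableT_comp.
have mY k : measurable_fun setT (Y k).
  apply: measurable_funM; last exact: (measurableT_comp (measurable_coord k)).
  apply: measurable_dotp => //; apply: measurable_fun_rV => i.
  under eq_fun do rewrite mxE.
  exact: (measurableT_comp (mqF i)).
have mh k : measurable_fun setT (h k).
  apply: measurable_funB => //.
  by apply: (measurableT_comp _ m12); exact: measurable_quotient_limsup.
pose X : {mfun W >-> 'rV[R]_d} := mfun_of (mx t).
have mZ j : measurable_fun setT (fun w => (xi t.+1 j w, u t.+1 j w)).
  exact: measurable_fun_pair.
pose Z (j : 'I_b) : {mfun W >-> (Xi * 'rV[R]_d)%type} := mfun_of (mZ j).
pose ev (B : 'I_b -> set Xi) (C : 'I_b -> set 'rV[R]_d) (k : 'I_b + 'I_b) : set W :=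
  match k with inl j => xi t.+1 j @^-1` B j | inr j => u t.+1 j @^-1` C j end.
have prod (A : set 'rV[R]_d) ks B C : measurable A -> uniq ks ->
    (forall j, measurable (B j)) -> (forall j, measurable (C j)) ->
    P (X @^-1` A `&` \big[setI/setT]_(k <- ks) ev B C k) =
    (P (X @^-1` A) * \prod_(k <- ks) P (ev B C k))%E.
  move=> mA uks mB mC.
  apply: (fresh_prod (zo_fresh run)) => //; first exact: sfw_iterate_history.
  move=> [j|j] _ /=; first by exists (B j); [exact: mB|rewrite setTI].
  by exists (C j); [exact: mC|rewrite setTI].
have prod2 (j : 'I_b) B C : measurable B -> measurable C ->
    P (xi t.+1 j @^-1` B `&` u t.+1 j @^-1` C) =
    (P (xi t.+1 j @^-1` B) * P (u t.+1 j @^-1` C))%E.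
  move=> mB mC.
  have := prod setT [:: inl j; inr j] (fun=> B) (fun=> C) measurableT isT
    (fun=> mB) (fun=> mC).
  by rewrite !big_cons !big_nil /= preimage_setT setTI setIT mule1 probability_setT mul1e.
have prod3 (j : 'I_b) A B C : measurable A -> measurable B -> measurable C ->
    P (X @^-1` A `&` (xi t.+1 j @^-1` B `&` u t.+1 j @^-1` C)) =
    (P (X @^-1` A) * P (xi t.+1 j @^-1` B `&` u t.+1 j @^-1` C))%E.
  move=> mA mB mC.
  have := prod A [:: inl j; inr j] (fun=> B) (fun=> C) mA isT (fun=> mB) (fun=> mC).
  by rewrite !big_cons !big_nil /= setIT mule1 prod2.
have prod5 (i j : 'I_b) A B C B' C' : i != j -> measurable A -> measurable B ->
    measurable C -> measurable B' -> measurable C' ->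
    P (X @^-1` A `&` (xi t.+1 i @^-1` B `&` u t.+1 i @^-1` C)
       `&` (xi t.+1 j @^-1` B' `&` u t.+1 j @^-1` C')) =
    (P (X @^-1` A `&` (xi t.+1 i @^-1` B `&` u t.+1 i @^-1` C))
     * P (xi t.+1 j @^-1` B' `&` u t.+1 j @^-1` C'))%E.
  move=> ij mA mB mC mB' mC'.
  have uij : uniq [:: inl i; inr i; inl j; inr j].
    have ijl : (inl i == inl j :> 'I_b + 'I_b) = false by exact: negbTE ij.
    have ijr : (inr i == inr j :> 'I_b + 'I_b) = false by exact: negbTE ij.
    by rewrite /= !inE ijl ijr.
  have := prod A _ (fun k => if k == i then B else B') (fun k => if k == i then C else C')
    mA uij (fun k => _) (fun k => _).
  rewrite !big_cons !big_nil /= eqxx eq_sym (negbTE ij) setIT mule1 => H.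
  rewrite -!setIA H; [|by move=> k; case: ifP..].
  by rewrite prod3// !prod2// !muleA.
have mu' j := measurable_funPT (u t.+1 j).
have mxi j := measurable_funPT (xi t.+1 j).
have indepX j : indep P X (Z j) by apply: indep_pairr => // A B C; exact: prod3.
have indepXZ i j : i != j -> indep P (fun w => (X w, Z i w)) (Z j).
  by move=> ij; apply: indep_pair_pairs => // A B C B' C'; exact: prod5.
have law j (G : Xi * 'rV[R]_d -> \bar R) :
    (\int[distribution P (Z j)]_z G z = \int[Pxi \x distribution P (u t.+1 j)]_z G z)%E.
  apply: eq_measure_integral => A mA _; apply/esym.
  apply: product_measure_unique => // B C mB mC.
  rewrite [LHS](prod2 j B C mB mC); congr (_ * _)%E.
  exact: (zo_law run (t := t.+1) tT (ltn_ord j) mB).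
have gauss (j : 'I_b) : std_gaussian (u t.+1 j) := zo_gaussian run (t := t.+1) tT (ltn_ord j).
have qFE w i z : qF i (X w, z) = grad (F ^~ z) (x t w) ord0 i.
  by rewrite /qF dF_grad//; apply: Ox; exact: ltnW.
have mYX w k : measurable_fun setT (fun p => Y k (X w, p)).
  by apply: (measurableT_comp (mY k)).
(* Unbiasedness: under the product law each term is a partial derivative times an entry of the
   identity covariance, so only [i = k] contributes. *)
have hY w k (j : 'I_b) :
    (distribution P (Z j)).-integrable setT (fun p => (Y k (X w, p))%:E) /\
    (\int[distribution P (Z j)]_p (Y k (X w, p))%:E = (grad f (x t w) ord0 k)%:E)%E.
  have Oxw := Ox _ w (ltnW tT).
  pose G : probability 'rV[R]_d R := distribution P (u t.+1 j).
  pose a i z : R := grad (F ^~ z) (x t w) ord0 i.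
  pose c i (y : 'rV[R]_d) : R := y ord0 i * y ord0 k.
  have mc i : measurable_fun setT (c i).
    by apply: measurable_funM; exact: measurable_coord.
  have YE p : (Y k (X w, p))%:E = (\sum_(i < d) (a i p.1 * c i p.2)%:E)%E.
    rewrite sumEFin /Y /dotp mulr_suml; congr EFin; apply: eq_bigr => i _.
    by rewrite mxE qFE mulrA.
  have ic i := gaussian_covariance (gauss j) i k.
  have iG i : G.-integrable setT (fun y => (c i y)%:E).
    by apply: integrable_distribution (ic i).1; exact/measurable_EFinP.
  have GE i : (\int[G]_y (c i y)%:E = (i == k)%:R%:E)%E.
    rewrite -(ic i).2; apply: (@integral_distribution _ _ _ _ _ P (u t.+1 j)).
      exact/measurable_EFinP.
    exact: (ic i).1.
  have ac i := integral_prodM (pb_grad_integrable pb i Oxw) (iG i).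
  have iY : (Pxi \x G)%E.-integrable setT (fun p => (Y k (X w, p))%:E).
    under eq_fun do rewrite YE.
    by apply: integrable_sum => // i _; exact: (ac i).1.
  have mYE : measurable_fun setT (fun p => (Y k (X w, p))%:E).
    exact/measurable_EFinP.
  split.
    apply/integrableP; split => //.
    by rewrite law; move/integrableP : iY => [].
  rewrite law; under eq_integral do rewrite YE.
  rewrite integral_sum//; last by move=> i; exact: (ac i).1.
  rewrite (bigD1 k)//= big1 ?adde0 => [|i /negbTE ik].
    rewrite (ac k).2 GE eqxx mule1.
    by have := pb_unbiased pb k Oxw; rewrite unlock.
  by rewrite (ac i).2 GE ik mule0.
(* The direction is integrated out first, with the sample gradient fixed, giving the factor [d + 2];
   the growth condition then handles the gradient. *)
have hY2 w (j : 'I_b) : (\sum_(k < d) \int[distribution P (Z j)]_p (Y k (X w, p) ^+ 2)%:E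
    <= ((d%:R + 2) * (2 * rho * L * gap (x t w)))%:E)%E.
  have Oxw := Ox _ w (ltnW tT).
  pose G : probability 'rV[R]_d R := distribution P (u t.+1 j).
  have mYX2 k : measurable_fun setT (fun p => (Y k (X w, p) ^+ 2)%:E).
    by apply/measurable_EFinP; apply: measurable_funX.
  rewrite -ge0_integral_sum//; last first.
    by move=> k p _; rewrite lee_fin sqr_ge0.
  pose S (p : Xi * 'rV[R]_d) : \bar R := (\sum_(k < d) (Y k (X w, p) ^+ 2)%:E)%E.
  have mS : measurable_fun setT S by exact: emeasurable_sum.
  have S0 p : (0 <= S p)%E.
    by apply: sume_ge0 => k _; rewrite lee_fin sqr_ge0.
  rewrite law (fubini_tonelli1 S)//.
  have mgr : measurable_fun setT (fun z : Xi => (enorm (grad (F ^~ z) (x t w)) ^+ 2)%:E).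
    apply/measurable_EFinP; apply: measurable_funX; apply: (measurableT_comp measurable_enorm).
    apply: measurable_fun_rV => i; under eq_fun do rewrite -qFE.
    exact: (measurableT_comp (mqF i)).
  apply: (@le_trans _ _ (\int[Pxi]_z ((d%:R + 2)%:E *
      (enorm (grad (F ^~ z) (x t w)) ^+ 2)%:E))%E).
    apply: ge0_le_integral => //.
    - by move=> z _; apply: integral_ge0.
    - exact: measurable_fun_fubini_tonelli_F.
    - exact: emeasurable_funM.
    - move=> z _; rewrite /fubini_F.
      have := gaussian_fourth_moment (gauss j) (grad (F ^~ z) (x t w)).
      rewrite EFinM; apply: le_trans.
      rewrite (@ge0_integral_distribution _ _ _ _ _ P (u t.+1 j) (fun y => S (z, y)))//; last first.
        exact: (measurableT_comp mS).
      rewrite le_eqVlt; apply/orP; left; apply/eqP; apply: eq_integral => w' _.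
      rewrite /S /= sumEFin; congr EFin; apply: eq_bigr => k _; rewrite /Y/=.
      by congr ((dotp _ _ * _) ^+ 2); apply/rowP => i; rewrite mxE qFE.
  rewrite ge0_integralZl_EFin//; last first.
    by move=> z _; rewrite lee_fin sqr_ge0.
  rewrite [leRHS]EFinM; apply: lee_wpmul2l; first by rewrite lee_fin addr_ge0.
  by have := zo_growth zoa Oxw; rewrite unlock.
have hE w k p : h k (X w, p) = Y k (X w, p) - grad f (x t w) ord0 k.
  by rewrite /h df_grad//; apply: Ox; exact: ltnW.
pose q w := \sum_(k < d) (b%:R^-1 * \sum_(j < b) h k (X w, Z j w)) ^+ 2.
have q0 w : 0 <= q w by apply: sumr_ge0 => k _; exact: sqr_ge0.
have mq : measurable_fun setT q.
  apply: measurable_sum => k; apply: measurable_funX; apply: measurable_funM => //.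
  apply: measurable_sum => j; apply: (measurableT_comp (mh k)).
  exact: measurable_fun_pair.
have Vint : (\int[P]_w ((d%:R + 2) * (2 * rho * L * gap (x t w)))%:E <=
    ((d%:R + 2) * (2 * rho * L * r))%:E)%E.
  under eq_integral do rewrite mulrA EFinM.
  rewrite ge0_integralZl_EFin//; last 3 first.
  - by move=> w _; rewrite lee_fin; apply/gap_ge0/Ox/ltnW.
  - exact/measurable_EFinP.
  - by rewrite !mulr_ge0 ?addr_ge0// ltW.
  rewrite [in leRHS]mulrA [leRHS]EFinM; apply: lee_wpmul2l => //.
  by rewrite lee_fin !mulr_ge0 ?addr_ge0// ltW.
have s1 : (\int[P]_w (q w)%:E <= (b%:R^-1 * ((d%:R + 2) * (2 * rho * L * r)))%:E)%E.
  have := @minibatch_variance _ _ _ _ _ _ _ P b d X Z h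
    (fun w => (d%:R + 2) * (2 * rho * L * gap (x t w))) b0 mh indepX indepXZ.
  move=> H; apply: le_trans (H _ _ _ _) _.
  - move=> k j w; under eq_integral do rewrite hE EFinB.
    have [iY YE] := hY w k j.
    rewrite integralB//; last exact: finite_measure_integrable_cst.
    by rewrite YE integral_cst//= probability_setT mule1 subee.
  - move=> j w; apply: le_trans (hY2 w j); apply: lee_sum => k _.
    under eq_integral do rewrite hE.
    by apply: integral_sqr_sub_mean_le; [exact: mYX|exact: (hY w k j).2].
  - by do 2 apply: measurable_funM => //.
  - by apply: le_lt_trans Vint _; exact: ltry.
  - by rewrite [leRHS]EFinM lee_wpmul2l ?lee_fin ?invr_ge0.
pose nn w := b%:R^-1 * \sum_(j < b) enorm (u t.+1 j w) ^+ 6.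
have bV0 : 0 <= b%:R^-1 :> R by rewrite invr_ge0.
have men j : measurable_fun setT (fun w => enorm (u t.+1 j w) ^+ 6).
  by apply: measurable_funX; exact: (measurableT_comp measurable_enorm).
have nn0 w : 0 <= nn w.
  by rewrite mulr_ge0//; apply: sumr_ge0 => j _; rewrite exprn_ge0 ?enorm_ge0.
have mnn : measurable_fun setT nn.
  by apply: measurable_funM => //; apply: measurable_sum.
have s2 : (\int[P]_w (nn w)%:E <= (15 * d%:R ^+ 3)%:E)%E.
  rewrite /nn; under eq_integral do rewrite EFinM -sumEFin.
  rewrite ge0_integralZl_EFin//; last 2 first.
  - by move=> w _; apply: sume_ge0 => j _; rewrite lee_fin exprn_ge0 ?enorm_ge0.
  - by apply: emeasurable_sum => j; exact/measurable_EFinP.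
  rewrite ge0_integral_sum//; last 2 first.
  - by move=> j; exact/measurable_EFinP.
  - by move=> j w _; rewrite lee_fin exprn_ge0 ?enorm_ge0.
  apply: (@le_trans _ _ ((b%:R^-1)%:E * \sum_(j < b) (15 * d%:R ^+ 3)%:E)%E).
    by rewrite lee_wpmul2l//; apply: lee_sum => j _; exact: gaussian_sixth_moment.
  rewrite sumEFin sumr_const card_ord -EFinM lee_fin -(mulr_natl (15 * _)).
  by rewrite mulKf// pnatr_eq0 -lt0n.
pose nu : R := zo_radius D d T.
pose q6 : R := (d%:R + 6) `^ (3 / 2).
have q6_gt0 : 0 < q6 by rewrite powR_gt0// addr_gt0.
have q6_sqr : q6 ^+ 2 = (d%:R + 6) ^+ 3.
  rewrite -[LHS]powR_mulrn ?ltW// /q6 -powRrM divfK//.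
  by rewrite -[RHS]powR_mulrn// addr_ge0.
have nuE : nu = D / ((T%:R + 3) * q6) by [].
have nu0 : 0 < nu by rewrite nuE divr_gt0// mulr_gt0// addr_gt0.
(* chosen so that [E|u|^6 <= 15 d^3 <= sm^2], in [|u|^3 <= |u|^6 / (2 sm) + sm / 2] *)
pose sm := 4 * q6.
have sm0 : 0 < sm by rewrite mulr_gt0.
(* The exceptional set of [Pxi] pulls back to a null set for each sample, and one iteration has
   finitely many of them. *)
have ae_smooth : {ae P, forall w, forall j : 'I_b, forall y y',
    enorm (grad (F ^~ (xi t.+1 j w)) y - grad (F ^~ (xi t.+1 j w)) y') <= L * enorm (y - y')}.
  apply: filter_forall => j.
  have [N [mN N0 bad]] := zo_smooth zoa.
  exists (xi t.+1 j @^-1` N); split.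
  - by rewrite -[X in measurable X]setTI; exact: measurable_funPT.
  - by rewrite (zo_law run (t := t.+1) tT (ltn_ord j) mN).
  - by move=> w /= H; apply: bad.
(* Half the weight of the first-order step: it leaves room for the remainder, and the larger batch
   makes up for the doubled factor of the squared error. *)
pose cY := rho * L * g / 2.
have cY0 : 0 < cY by rewrite divr_gt0// !mulr_gt0.
pose kk := g * (cY * D ^+ 2 / 2) + g * (L * nu * D * sm / 4) + L / 2 * g ^+ 2 * D ^+ 2.
have qE w : q w = enorm (b%:R^-1 *: \sum_(j < b)
    dotp (grad (F ^~ (xi t.+1 j w)) (x t w)) (u t.+1 j w) *: u t.+1 j w - grad f (x t w)) ^+ 2.
  rewrite enorm_sqr; apply: eq_bigr => k _; rewrite row_subE -expr2.
  congr (_ ^+ 2); rewrite mxE summxE.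
  under eq_bigr do rewrite hE.
  rewrite sumrB sumr_const card_ord mulrBr -(mulr_natl (grad f _ _ _)).
  rewrite mulKf; last by rewrite pnatr_eq0 -lt0n.
  congr (_ * _ - _); apply: eq_bigr => j _; rewrite mxE /Y/=.
  by congr (dotp _ _ * _); apply/rowP => i; rewrite mxE qFE.
have pw : {ae P, forall w, gap (x t.+1 w) <= (1 - g) * gap (x t w) + (g / (2 * cY)) * q w
    + g * (L * nu * D / (4 * sm)) * nn w + kk}.
  apply: filterS ae_smooth => w smooth.
  have [Oxw Oxw'] := (Ox _ w (ltnW tT), (pb_minimum pb).1).
  have lmo := zo_lmo run w tT.
  have g01 : 0 <= g <= 1 by rewrite g0.
  have := frank_wolfe_step (ltW hL) g01 (pb_convex pb) (pb_diameter pb)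
    (pb_f_convex pb) (pb_f_differentiable pb) (pb_f_smooth pb) Oxw' Oxw lmo.
  move/le_trans; apply.
  have vD : enorm (v t.+1 w - xstar) <= D by apply: (pb_diameter pb) => //; exact: Ov.
  have := @zo_error_le R d b L nu D sm (grad f (x t w)) (v t.+1 w - xstar)
    (fun j => grad (F ^~ (xi t.+1 j w)) (x t w)) (fun j => u t.+1 j w)
    (fun j => (F (x t w + nu *: u t.+1 j w) (xi t.+1 j w) - F (x t w) (xi t.+1 j w)) / nu)
    b0 (ltW hL) (ltW nu0) sm0 vD.
  have quad (j : 'I_b) : `|(F (x t w + nu *: u t.+1 j w) (xi t.+1 j w)
      - F (x t w) (xi t.+1 j w)) / nu
      - dotp (grad (F ^~ (xi t.+1 j w)) (x t w)) (u t.+1 j w)|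
      <= L / 2 * nu * enorm (u t.+1 j w) ^+ 2.
    have : `|F (x t w + nu *: u t.+1 j w) (xi t.+1 j w) - F (x t w) (xi t.+1 j w)
        - dotp (grad (F ^~ (xi t.+1 j w)) (x t w)) (nu *: u t.+1 j w)|
        <= L / 2 * enorm (nu *: u t.+1 j w) ^+ 2.
      apply: (@quadratic_bound R d (F ^~ (xi t.+1 j w))) => [s' _|s' /andP[s'0 _]].
        exact: zo_differentiable zoa _ _.
      apply: le_trans (smooth j _ _) _.
      by rewrite (addrC (x t w)) addrK enormZ (ger0_norm s'0).
    rewrite dotpZr enormZ (gtr0_norm nu0) exprMn => H.
    set A := F _ _ - F _ _ in H *; set p := dotp _ _ in H *.
    have -> : A / nu - p = (A - nu * p) / nu by field; rewrite gt_eqF.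
    rewrite normrM normfV (gtr0_norm nu0) ler_pdivrMr//; apply: le_trans H _.
    by rewrite le_eqVlt; apply/orP; left; apply/eqP; ring.
  move=> /(_ quad).
  rewrite -/(nn w) => H.
  have := le_trans H (lerD (lerD (young D _ cY0) (lexx _)) (lexx _)).
  rewrite -qE => /(ler_wpM2l g0) H'.
  apply: (@le_trans _ _ ((1 - g) * gap (x t w) + g * (cY * D ^+ 2 / 2 + q w / (2 * cY)
    + L * nu * D / (4 * sm) * nn w + L * nu * D * sm / 4) + L / 2 * g ^+ 2 * D ^+ 2)).
    by rewrite lerD2r lerD2l.
  by rewrite /kk le_eqVlt; apply/orP; left; apply/eqP; ring.
have kk0 : 0 <= kk.
  by rewrite /kk !(addr_ge0, mulr_ge0, sqr_ge0, divr_ge0)// ltW.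
have := @ae_expected_le _ _ _ P (fun w => gap (x t.+1 w)) (fun w => gap (x t w)) q
  nn (1 - g) (g / (2 * cY)) (g * (L * nu * D / (4 * sm))) kk
  r _ _ (mgap _) (mgap _) mq mnn (fun w => gap_ge0 (Ox _ w tT))
  (fun w => gap_ge0 (Ox _ w (ltnW tT))) q0 nn0 _ _ _ kk0
  pw ir s1 s2.
rewrite subr_ge0 => /(_ g1 _ _)/le_trans; apply.
- by rewrite divr_ge0// mulr_ge0// ltW.
- by rewrite mulr_ge0// divr_ge0// !mulr_ge0// ltW.
rewrite lee_fin.
have t4 : 0 < t%:R + 4 :> R by rewrite ltr_wpDl.
have d4 : 0 < d%:R + 4 :> R by rewrite ltr_wpDl.
have gE : g = 4 / (t%:R + 4) by rewrite /g /step_size -[t.+1%:R]natr1; congr (_ / _); ring.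
have d2 : 0 <= d%:R :> R by [].
(* The factor [d + 4] of the batch size absorbs the [d + 2] of the fourth moment. *)
have h1 : g / (2 * cY) * (b%:R^-1 * ((d%:R + 2) * (2 * rho * L * r))) <= g / 2 * r.
  have bE : b%:R = (t%:R + 4) * (d%:R + 4) :> R.
    by rewrite /b /zo_batch natrM !natrD -[t.+1%:R]natr1; ring.
  rewrite [leLHS](_ : _ = (d%:R + 2) / (d%:R + 4) * (g / 2 * r)); last first.
    rewrite bE gE /cY gE; field.
    by rewrite !gt_eqF.
  rewrite ler_piMl ?mulr_ge0 ?divr_ge0//.
  by rewrite ler_pdivrMr// mul1r lerD2l ler_nat.
(* The sixth-moment part of the remainder is at most its constant part, so twice the latter covers
   both. *)
have h2 : g * (L * nu * D / (4 * sm)) * (15 * d%:R ^+ 3) <= g * (L * nu * D * sm / 4).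
  rewrite [leRHS](_ : _ = g * (L * nu * D / (4 * sm)) * sm ^+ 2); last first.
    by field; rewrite gt_eqF.
  apply: ler_wpM2l; first by rewrite mulr_ge0// divr_ge0// !mulr_ge0// ltW.
  rewrite /sm exprMn q6_sqr.
  have : d%:R ^+ 3 <= (d%:R + 6) ^+ 3 :> R.
    by rewrite lerXn2r ?nnegrE ?addr_ge0// lerDl.
  have : 0 <= d%:R ^+ 3 :> R by rewrite exprn_ge0.
  lra.
(* The dimension cancels in [nu * sm = 4 * D / (T + 3)], and [4 / (T + 3) <= g] because [t.+1 <= T].
   This is why [nu] depends on the horizon. *)
have h3 : g * (L * nu * D * sm / 4) * 2 <= g ^+ 2 * L * D ^+ 2 / 2.
  have T3 : 0 < T%:R + 3 :> R by rewrite ltr_wpDl.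
  have -> : g * (L * nu * D * sm / 4) * 2 = 2 * g * L * D ^+ 2 * (T%:R + 3)^-1.
    by rewrite nuE /sm; field; rewrite !gt_eqF.
  have -> : g ^+ 2 * L * D ^+ 2 / 2 = 2 * g * L * D ^+ 2 * (g / 4) by field.
  apply: ler_wpM2l; first by rewrite !mulr_ge0// ltW.
  have -> : g / 4 = (t%:R + 4)^-1 by rewrite gE; field; rewrite gt_eqF.
  rewrite lef_pV2 ?posrE//.
  have : t.+1%:R <= T%:R :> R by rewrite ler_nat.
  rewrite -[t.+1%:R]natr1; lra.
(* The deficit between the budget and [(rho + rho^-1 + 1) / 2], and the only source of [rho^-1]. *)
have h4 : 1 / 2 <= rho / 4 + rho^-1 / 2.
  have : 0 <= rho^-1 / 4 * ((rho - 1) ^+ 2 + 1).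
    by rewrite mulr_ge0 ?divr_ge0 ?invr_ge0 ?addr_ge0 ?sqr_ge0 ?(ltW hrho)//.
  have -> : rho^-1 / 4 * ((rho - 1) ^+ 2 + 1) = rho / 4 + rho^-1 / 2 - 1 / 2.
    by field; rewrite gt_eqF.
  by rewrite subr_ge0.
have h5 := ler_wpM2l (mulr_ge0 (mulr_ge0 (sqr_ge0 g) (ltW hL)) (sqr_ge0 D)) h4.
have h6 : g * (cY * D ^+ 2 / 2) = g ^+ 2 * L * D ^+ 2 * (rho / 4).
  by rewrite /cY; field.
rewrite /kk h6; lra.
Qed.
End steps.

(** * Rates and oracle complexity *)

(** The step accepts any real bound [r] on an extended expectation, so finiteness of the expected
    gaps comes out of the induction. *)
Lemma rate_recursion {R : realType} (e : nat -> \bar R) (d0 K : R) (T : nat) :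
  0 <= d0 -> 0 <= K -> (e 0%N <= d0%:E)%E ->
  (forall t r, (t < T)%N -> 0 <= r -> (e t <= r%:E)%E ->
    (e t.+1 <= ((1 - step_size t.+1 / 2) * r + step_size t.+1 ^+ 2 * K / 2)%:E)%E) ->
  forall t, (1 <= t <= T)%N -> (e t <= ((2 * d0 + 8 * K) / (t%:R + 3))%:E)%E.
Proof.
move=> d00 K0 e0 step; elim=> [//|t IH] /= tT.
have t3 : 0 < t%:R + 3 :> R by rewrite ltr_wpDl.
have t4 : 0 < t%:R + 4 :> R by rewrite ltr_wpDl.
have gE : step_size t.+1 = 4 / (t%:R + 4) :> R.
  by rewrite /step_size -[t.+1%:R]natr1; congr (_ / _); ring.
have -> : t.+1%:R + 3 = t%:R + 4 :> R by rewrite -[t.+1%:R]natr1; ring.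
(* The rate is not claimed at [t = 0], where [(2 * d0 + 8 * K) / 3] may be smaller than [d0]. The
   first step has step size 1 and halves [d0], which accounts for [2 * d0] over 4. *)
case: t => [|t] in IH tT t3 t4 gE *.
  apply: le_trans (step 0 d0 tT d00 e0) _; rewrite gE lee_fin.
  by rewrite !add0r; lra.
set A := 2 * d0 + 8 * K in IH *.
have A0 : 0 <= A by rewrite addr_ge0// mulr_ge0.
apply: le_trans (step t.+1 _ tT _ (IH (ltnW tT))) _.
  by rewrite divr_ge0// ltW.
rewrite gE lee_fin; set n := t.+1%:R in t3 t4 *.
have K8 : 8 * K <= A by rewrite lerDr mulr_ge0.
rewrite -subr_ge0.
(* The slack is nonnegative as soon as [8 * K <= A], which is where the 8 of the rate comes from. *)
have -> : A / (n + 4) - ((1 - 4 / (n + 4) / 2) * (A / (n + 3)) + (4 / (n + 4)) ^+ 2 * K / 2)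
    = ((A - 8 * K) * (n + 3) + A) / ((n + 4) ^+ 2 * (n + 3)).
  by field; rewrite !gt_eqF.
rewrite divr_ge0//.
  by rewrite addr_ge0// mulr_ge0 ?subr_ge0// ltW.
by rewrite mulr_ge0 ?sqr_ge0// ltW.
Qed.

Lemma sum_nat_le (b : nat -> nat) (M T : nat) :
  (forall t, (t <= T)%N -> (b t <= M)%N) -> (\sum_(1 <= t < T.+1) b t <= T * M)%N.
Proof.
move=> bM; rewrite -[T in (T * M)%N](subn1 T.+1) -sum_nat_const_nat.
by rewrite !big_nat leq_sum// => t /andP[_ tT]; exact: bM.
Qed.

Section rates.
Context {R : realType} {d : nat} {dX : measure_display} {Xi : measurableType dX}
  {dW : measure_display} {W : measurableType dW}.
Variables (P : probability W R) (Pxi : probability Xi R).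
Variables (L D rho : R) (Omega : set 'rV[R]_d) (F : 'rV[R]_d -> Xi -> R)
  (f : 'rV[R]_d -> R) (x0 xstar : 'rV[R]_d).
Hypotheses (hL : 0 < L) (hD : 0 < D) (hrho : 0 < rho).
Hypothesis pb : sfw_problem L D Pxi Omega F f x0 xstar.
Variable v : nat -> {RV P >-> 'rV[R]_d}.

Let initial_gap :
  ('E_P[fun w => (f (sfw_iterate step_size x0 v 0 w) - f xstar)%R]
    <= (f x0 - f xstar)%:E)%E.
Proof. by rewrite unlock /= integral_cst//= probability_setT mule1. Qed.

Lemma first_order_rate (T t : nat) (xi : nat -> nat -> {RV P >-> Xi}) :
  first_order_assumption L rho Pxi Omega F f xstar ->
  first_order_run Pxi Omega F x0 step_size fo_batch T xi v ->
  (1 <= t <= T)%N ->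
  ('E_P[fun w => (f (sfw_iterate step_size x0 v t w) - f xstar)%R]
     <= ((2 * (f x0 - f xstar) + 8 * (rho + 1) * L * D ^+ 2) / (t%:R + 3))%:E)%E.
Proof.
move=> foa run tT; rewrite -!(mulrA 8).
apply: (@rate_recursion _ (fun t => 'E_P[_]%E) _ _ T) => //.
- exact: gap_ge0 pb _ (pb_start pb).
- by rewrite !mulr_ge0 ?addr_ge0 ?sqr_ge0// ltW.
- move=> s r sT r0; rewrite unlock; exact: (first_order_step hL hD hrho pb foa run sT r0).
Qed.

Lemma zeroth_order_rate (T t : nat) (xi : nat -> nat -> {RV P >-> Xi})
    (u : nat -> nat -> {RV P >-> 'rV[R]_d}) :
  zeroth_order_assumption L rho Pxi Omega F f xstar ->
  zeroth_order_run Pxi Omega F x0 step_size (zo_batch d) (zo_radius D d T) T xi u v ->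
  (1 <= t <= T)%N ->
  ('E_P[fun w => (f (sfw_iterate step_size x0 v t w) - f xstar)%R]
     <= ((2 * (f x0 - f xstar) + 8 * (rho + rho^-1 + 1) * L * D ^+ 2)
          / (t%:R + 3))%:E)%E.
Proof.
move=> zoa run tT; rewrite -!(mulrA 8).
apply: (@rate_recursion _ (fun t => 'E_P[_]%E) _ _ T) => //.
- exact: gap_ge0 pb _ (pb_start pb).
- by rewrite !mulr_ge0 ?addr_ge0 ?invr_ge0 ?sqr_ge0// ltW.
- move=> s r sT r0; rewrite unlock; exact: (zeroth_order_step hL hD hrho pb zoa run sT r0).
Qed.
End rates.

(** Take the integer part of [A / eps] plus one; [eps <= A] lets the added one be absorbed by
    doubling. *)
Lemma iteration_count {R : realType} (A eps : R) : 0 < A -> 0 < eps <= A ->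
  exists T : nat, [/\ (1 <= T)%N, T%:R <= 2 * A * eps^-1 & A / (T%:R + 3) <= eps].
Proof.
move=> A0 /andP[eps0 epsA].
have q1 : 1 <= A / eps by rewrite ler_pdivlMr ?mul1r.
have /andP[lo hi] := truncn_itv (le_trans ler01 q1).
exists (Num.truncn (A / eps)).+1; split => //.
  rewrite -[_.+1%:R]natr1 -mulrA; lra.
rewrite ler_pdivrMr ?ltr_wpDl// mulrC -ler_pdivrMr//.
by rewrite (le_trans (ltW hi))// lerDl.
Qed.

Lemma first_order_calls_le (T : nat) : (1 <= T)%N ->
  (first_order_calls fo_batch T <= 4 * T ^ 2)%N.
Proof.
move=> T1; apply: (@leq_trans (T * (T + 3))); last by nia.
by apply: sum_nat_le => t tT; rewrite /fo_batch; lia.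
Qed.

(** Here 40 is 2 evaluations times 4 from [T + 3 <= 4 * T] times 5 from [d + 4 <= 5 * d], the last
    using a positive dimension. *)
Lemma zeroth_order_calls_le (d T : nat) : (0 < d)%N -> (1 <= T)%N ->
  (zeroth_order_calls (zo_batch d) T <= 40 * d * T ^ 2)%N.
Proof.
move=> d0 T1; apply: (@leq_trans (T * (2 * ((T + 3) * (d + 4))))).
  by apply: sum_nat_le => t tT; rewrite /zo_batch leq_mul2l leq_mul2r leq_add2r tT orbT.
have : ((T + 3) * (d + 4) <= (4 * T) * (5 * d))%N by rewrite leq_mul//; lia.
nia.
Qed.

Lemma lmo_callsE (T : nat) : lmo_calls T = T.
Proof. by rewrite /lmo_calls sum_nat_const_nat muln1 subn1. Qed.

Lemma count_sqr_le {R : realType} (A eps : R) (T : nat) : 0 < eps ->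
  T%:R <= 2 * A * eps^-1 -> T%:R ^+ 2 <= 4 * A ^+ 2 * eps ^- 2.
Proof.
move=> eps0 TA; have -> : 4 * A ^+ 2 * eps ^- 2 = (2 * A * eps^-1) ^+ 2.
  by field; rewrite gt_eqF.
by rewrite lerXn2r ?nnegrE// (le_trans _ TA).
Qed.

Theorem theorem2 (R : realType) (L D rho : R)
    (hL : 0 < L) (hD : 0 < D) (hrho : 0 < rho) :
  (* (a) first-order setting *)
  ((forall (d : nat) (dX : measure_display) (Xi : measurableType dX)
      (Pxi : probability Xi R) (Omega : set 'rV[R]_d) (F : 'rV[R]_d -> Xi -> R)
      (f : 'rV[R]_d -> R) (x0 xstar : 'rV[R]_d),
      (0 < d)%N ->
      sfw_problem L D Pxi Omega F f x0 xstar ->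
      first_order_assumption L rho Pxi Omega F f xstar ->
      forall (dW : measure_display) (W : measurableType dW) (P : probability W R)
        (T : nat) (xi : nat -> nat -> {RV P >-> Xi})
        (v : nat -> {RV P >-> 'rV[R]_d}),
      first_order_run Pxi Omega F x0 step_size fo_batch T xi v ->
      forall t : nat, (1 <= t <= T)%N ->
      ('E_P[fun w => (f (sfw_iterate step_size x0 v t w) - f xstar)%R]
         <= ((2 * (f x0 - f xstar) + 8 * (rho + 1) * L * D ^+ 2)
              / (t%:R + 3))%:E)%E)
   /\
   (forall Delta : R, exists C eps0 : R, 0 < C /\ 0 < eps0 /\
      forall (d : nat) (dX : measure_display) (Xi : measurableType dX)
        (Pxi : probability Xi R) (Omega : set 'rV[R]_d) (F : 'rV[R]_d -> Xi -> R)
        (f : 'rV[R]_d -> R) (x0 xstar : 'rV[R]_d),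
      (0 < d)%N ->
      sfw_problem L D Pxi Omega F f x0 xstar ->
      first_order_assumption L rho Pxi Omega F f xstar ->
      f x0 - f xstar = Delta ->
      forall eps : R, 0 < eps <= eps0 ->
      exists T : nat, (1 <= T)%N /\
        (first_order_calls fo_batch T)%:R <= C * eps ^- 2 /\
        (lmo_calls T)%:R <= C * eps^-1 /\
        forall (dW : measure_display) (W : measurableType dW)
          (P : probability W R) (xi : nat -> nat -> {RV P >-> Xi})
          (v : nat -> {RV P >-> 'rV[R]_d}),
        first_order_run Pxi Omega F x0 step_size fo_batch T xi v ->
        eps_optimal P Omega f xstar eps (sfw_iterate step_size x0 v T)))
  /\
  (* (b) zeroth-order setting *)
  ((forall (d : nat) (dX : measure_display) (Xi : measurableType dX)
      (Pxi : probability Xi R) (Omega : set 'rV[R]_d) (F : 'rV[R]_d -> Xi -> R)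
      (f : 'rV[R]_d -> R) (x0 xstar : 'rV[R]_d),
      (0 < d)%N ->
      sfw_problem L D Pxi Omega F f x0 xstar ->
      zeroth_order_assumption L rho Pxi Omega F f xstar ->
      forall (dW : measure_display) (W : measurableType dW) (P : probability W R)
        (T : nat) (xi : nat -> nat -> {RV P >-> Xi})
        (u : nat -> nat -> {RV P >-> 'rV[R]_d}) (v : nat -> {RV P >-> 'rV[R]_d}),
      zeroth_order_run Pxi Omega F x0 step_size (zo_batch d) (zo_radius D d T)
        T xi u v ->
      forall t : nat, (1 <= t <= T)%N ->
      ('E_P[fun w => (f (sfw_iterate step_size x0 v t w) - f xstar)%R]
         <= ((2 * (f x0 - f xstar) + 8 * (rho + rho^-1 + 1) * L * D ^+ 2)
              / (t%:R + 3))%:E)%E)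
   /\
   (forall Delta : R, exists C eps0 : R, 0 < C /\ 0 < eps0 /\
      forall (d : nat) (dX : measure_display) (Xi : measurableType dX)
        (Pxi : probability Xi R) (Omega : set 'rV[R]_d) (F : 'rV[R]_d -> Xi -> R)
        (f : 'rV[R]_d -> R) (x0 xstar : 'rV[R]_d),
      (0 < d)%N ->
      sfw_problem L D Pxi Omega F f x0 xstar ->
      zeroth_order_assumption L rho Pxi Omega F f xstar ->
      f x0 - f xstar = Delta ->
      forall eps : R, 0 < eps <= eps0 ->
      exists T : nat, (1 <= T)%N /\
        (zeroth_order_calls (zo_batch d) T)%:R <= C * d%:R * eps ^- 2 /\
        (lmo_calls T)%:R <= C * eps^-1 /\
        forall (dW : measure_display) (W : measurableType dW)
          (P : probability W R) (xi : nat -> nat -> {RV P >-> Xi})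
          (u : nat -> nat -> {RV P >-> 'rV[R]_d}) (v : nat -> {RV P >-> 'rV[R]_d}),
        zeroth_order_run Pxi Omega F x0 step_size (zo_batch d) (zo_radius D d T)
          T xi u v ->
        eps_optimal P Omega f xstar eps (sfw_iterate step_size x0 v T))).
Proof.
split; split.
- move=> d dX Xi Pxi Omega F f x0 xstar _ pb foa dW W P T xi v run t tT.
  exact: (first_order_rate hL hD hrho pb foa run tT).
- move=> Delta.
  (* [Delta] is an arbitrary real when the constants are chosen; the absolute value keeps [A]
     positive. *)
  pose A := 2 * `|Delta| + 8 * (rho + 1) * L * D ^+ 2.
  have A0 : 0 < A.
    by rewrite ltr_wpDl ?mulr_ge0// !mulr_gt0 ?addr_gt0 ?exprn_gt0.
  (* One constant for both counts: [2 * A] bounds [T * eps], and [16 * A ^+ 2] comes from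
     [4 * T ^ 2] calls with [T <= 2 * A / eps]. *)
  exists (2 * A + 16 * A ^+ 2), A.
  have C1 : 0 < 2 * A by rewrite mulr_gt0.
  have C2 : 0 < 16 * A ^+ 2 by rewrite mulr_gt0// exprn_gt0.
  split; first by rewrite addr_gt0.
  split=> // d dX Xi Pxi Omega F f x0 xstar _ pb foa DE eps epsA.
  have /andP[eps0 _] := epsA.
  have e1 : 0 < eps^-1 by rewrite invr_gt0.
  have e2 : 0 < eps ^- 2 by rewrite invr_gt0 exprn_gt0.
  have [T [T1 TA TE]] := iteration_count A0 epsA.
  exists T; split=> //; split; last split.
  + apply: (@le_trans _ _ (4 * T%:R ^+ 2)).
      by rewrite -natrX -natrM ler_nat first_order_calls_le.
    have := count_sqr_le eps0 TA; have := mulr_gt0 C1 e2; lra.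
  + rewrite lmo_callsE (le_trans TA)// ler_wpM2r ?ltW//; lra.
  + move=> dW W P xi v run; split.
      move=> w; apply: (sfw_iterate_in pb (T := T)) => // s sT.
      exact: (fo_lmo run w sT).1.
    apply: le_trans (first_order_rate hL hD hrho pb foa run (t := T) _) _.
      by rewrite T1 leqnn.
    rewrite lee_fin; apply: le_trans TE; rewrite ler_wpM2r ?invr_ge0 ?addr_ge0//.
    by rewrite DE /A lerD2r ler_wpM2l// ler_norm.
- move=> d dX Xi Pxi Omega F f x0 xstar _ pb zoa dW W P T xi u v run t tT.
  exact: (zeroth_order_rate hL hD hrho pb zoa run tT).
- move=> Delta.
  pose A := 2 * `|Delta| + 8 * (rho + rho^-1 + 1) * L * D ^+ 2.
  have A0 : 0 < A.
    by rewrite ltr_wpDl ?mulr_ge0// !mulr_gt0 ?addr_gt0 ?invr_gt0 ?exprn_gt0.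
  (* As before with [40 * d * T ^ 2] calls; the factor [d] stays outside, so the constant is free of
     the dimension. *)
  exists (2 * A + 160 * A ^+ 2), A.
  have C1 : 0 < 2 * A by rewrite mulr_gt0.
  have C2 : 0 < 160 * A ^+ 2 by rewrite mulr_gt0// exprn_gt0.
  split; first by rewrite addr_gt0.
  split=> // d dX Xi Pxi Omega F f x0 xstar d0 pb zoa DE eps epsA.
  have /andP[eps0 _] := epsA.
  have e1 : 0 < eps^-1 by rewrite invr_gt0.
  have e2 : 0 < eps ^- 2 by rewrite invr_gt0 exprn_gt0.
  have dR : 0 < d%:R :> R by rewrite ltr0n.
  have [T [T1 TA TE]] := iteration_count A0 epsA.
  exists T; split=> //; split; last split.
  + apply: (@le_trans _ _ (40 * d%:R * T%:R ^+ 2)).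
      by rewrite -natrX -!natrM ler_nat zeroth_order_calls_le.
    have /(ler_wpM2l (ltW dR)) := count_sqr_le eps0 TA.
    have := mulr_gt0 (mulr_gt0 C1 dR) e2; lra.
  + rewrite lmo_callsE (le_trans TA)// ler_wpM2r ?ltW//; lra.
  + move=> dW W P xi u v run; split.
      move=> w; apply: (sfw_iterate_in pb (T := T)) => // s sT.
      exact: (zo_lmo run w sT).1.
    apply: le_trans (zeroth_order_rate hL hD hrho pb zoa run (t := T) _) _.
      by rewrite T1 leqnn.
    rewrite lee_fin; apply: le_trans TE; rewrite ler_wpM2r ?invr_ge0 ?addr_ge0//.
    by rewrite DE /A lerD2r ler_wpM2l// ler_norm.
Qed.
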